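(* For each $\mathsf{L}_c$-stable class $K$ of Boolean functions there exist clones $C_1^K$ and $C_2^K$ such that for every clone $C$ of Boolean functions, $KC\subseteq K$ if and only if $C\subseteq C_1^K$, and $CK\subseteq K$ if and only if $C\subseteq C_2^K$. The clones $C_1^K$ and $C_2^K$ are those given in the following table, whose rows list all $\mathsf{L}_c$-stable classes $K$ (parameters: $a,b\in\{0,1\}$ and integers $k\geq 1$, $i>j\geq 1$): \[ \begin{array}{llll} K & \text{condition} & C_1^K & C_2^K\\ \hline \Omega & & \Omega & \Omega\\ \Omega_{a*} & & \mathsf{T}_0 & \mathsf{T}_a\\ \Omega_{*a} & & \mathsf{T}_1 & \mathsf{T}_a\\ \Omega_{=} & & \mathsf{T}_c & \Omega\\ \Omega_{\neq} & & \mathsf{T}_c & \mathsf{S}\\ \Omega_{ab} & & \mathsf{T}_c & \mathsf{T}_a\cap\mathsf{T}_b\\ \hline \mathsf{X}_k & k\geq 2 & \mathsf{LS} & \mathsf{L}\\ \mathsf{X}_1 & & \mathsf{S} & \mathsf{L}\\ \mathsf{X}_k\cap\Omega_{a*} & k\geq 2 & \mathsf{L}_c & \mathsf{L}_a\\ \mathsf{X}_1\cap\Omega_{a*} & & \mathsf{S}_c & \mathsf{L}_a\\ \mathsf{X}_k\cap\Omega_{*a} & k\geq 2 & \mathsf{L}_c & \mathsf{L}_a\\ \mathsf{X}_1\cap\Omega_{*a} & & \mathsf{S}_c & \mathsf{L}_a\\ \mathsf{X}_k\cap\Omega_{=} & k\geq 2 & \mathsf{L}_c & \mathsf{L}\\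 \mathsf{X}_1\cap\Omega_{=} & & \mathsf{S} & \Omega\\ \mathsf{X}_k\cap\Omega_{\neq} & k\geq 2 & \mathsf{L}_c & \mathsf{LS}\\ \mathsf{X}_1\cap\Omega_{\neq} & & \mathsf{S} & \mathsf{S}\\ \mathsf{X}_k\cap\Omega_{ab} & k\geq 2 & \mathsf{L}_c & \mathsf{L}_a\cap\mathsf{L}_b\\ \mathsf{X}_1\cap\Omega_{ab} & a=b & \mathsf{S}_c & \mathsf{T}_a\\ \mathsf{X}_1\cap\Omega_{ab} & a\neq b & \mathsf{S}_c & \mathsf{S}_c\\ \hline \mathsf{D}_k & k\geq 1 & \mathsf{L} & \mathsf{L}\\ \mathsf{D}_k\cap\Omega_{a*} & k\geq 1 & \mathsf{L}_0 & \mathsf{L}_a\\ \mathsf{D}_k\cap\Omega_{*a} & k\geq 1 & \mathsf{L}_1 & \mathsf{L}_a\\ \mathsf{D}_k\cap\Omega_{=} & k\geq 2 & \mathsf{L}_c & \mathsf{L}\\ \mathsf{D}_1\cap\Omega_{=} & & \mathsf{LS} & \mathsf{L}\\ \mathsf{D}_k\cap\Omega_{\neq} & k\geq 2 & \mathsf{L}_c & \mathsf{LS}\\ \mathsf{D}_1\cap\Omega_{\neq} & & \mathsf{LS} & \mathsf{LS}\\ \mathsf{D}_k\cap\Omega_{ab} & k\geq 1 & \mathsf{L}_c & \mathsf{L}_a\cap\mathsf{L}_b\\ \hline \mathsf{D}_i\cap\mathsf{X}_j & & \mathsf{LS} & \mathsf{L}\\ \mathsf{D}_i\cap\mathsf{X}_j\cap\Omega_{a*}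 & & \mathsf{L}_c & \mathsf{L}_a\\ \mathsf{D}_i\cap\mathsf{X}_j\cap\Omega_{*a} & & \mathsf{L}_c & \mathsf{L}_a\\ \mathsf{D}_i\cap\mathsf{X}_j\cap\Omega_{=} & j\geq 2 & \mathsf{L}_c & \mathsf{L}\\ \mathsf{D}_i\cap\mathsf{X}_1\cap\Omega_{=} & i\geq 2 & \mathsf{LS} & \mathsf{L}\\ \mathsf{D}_i\cap\mathsf{X}_j\cap\Omega_{\neq} & j\geq 2 & \mathsf{L}_c & \mathsf{LS}\\ \mathsf{D}_i\cap\mathsf{X}_1\cap\Omega_{\neq} & i\geq 2 & \mathsf{LS} & \mathsf{LS}\\ \mathsf{D}_i\cap\mathsf{X}_j\cap\Omega_{ab} & & \mathsf{L}_c & \mathsf{L}_a\cap\mathsf{L}_b\\ \hline \mathsf{D}_0 & & \Omega & \Omega\\ \mathsf{D}_0\cap\Omega_{a*} & & \Omega & \mathsf{T}_a\\ \emptyset & & \Omega & \Omega \end{array} \]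
   Context: A Boolean function is a map $f\colon\{0,1\}^n\to\{0,1\}$ with $n\geq 1$ (its arity); $\Omega$ is the set of all Boolean functions. For $f$ of arity $n$ and $g_1,\dots,g_n$ all of arity $m$, the composition $f(g_1,\dots,g_n)$ is the $m$-ary function $\mathbf{x}\mapsto f(g_1(\mathbf{x}),\dots,g_n(\mathbf{x}))$. For classes $C,K\subseteq\Omega$, $CK:=\{f(g_1,\dots,g_n)\mid f\in C\ n\text{-ary},\ g_1,\dots,g_n\in K\ \text{all } m\text{-ary},\ n,m\geq 1\}$. A clone is a class $C\subseteq\Omega$ containing all projections with $CC\subseteq C$. For a clone $C$, a class $K\subseteq\Omega$ is $C$-stable if $KC\subseteq K$ and $CK\subseteq K$. Every $n$-ary Boolean function has a unique multilinear (Zhegalkin) polynomial over $\mathrm{GF}(2)$, $f=\sum_{S\in M_f}\prod_{i\in S}x_i$ with $M_f\subseteq\mathcal{P}(\{1,\dots,n\})$. $\deg(f):=\max_{S\in M_f}|S|$ for $f\neq 0$, $\deg(0):=0$. For $k\in\{0,1,2,\dots\}$, $\mathsf{D}_k:=\{f\in\Omega\mid\deg(f)\leq k\}$. For $S\subseteq\{1,\dots,n\}$, $\mathrm{ch}(S,f):=|\{A\in M_f\mid S\subsetneq A\}|\bmod 2$. The characteristic rank $\chi(f)$ is the smallest nonnegative integer $m$ such that $\mathrm{ch}(S,f)=0$ for all $S\subseteq\{1,\dots,n\}$ with $|S|\geq m$. $\mathsf{X}_k:=\{f\in\Omega\mid\chi(f)\leq k\}$. For $a,b\in\{0,1\}$: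 $\Omega_{a*}:=\{f\mid f(0,\dots,0)=a\}$, $\Omega_{*b}:=\{f\mid f(1,\dots,1)=b\}$, $\Omega_{ab}:=\Omega_{a*}\cap\Omega_{*b}$; $\Omega_{=}:=\{f\mid f(0,\dots,0)=f(1,\dots,1)\}$, $\Omega_{\neq}:=\{f\mid f(0,\dots,0)\neq f(1,\dots,1)\}$. Clones: $\mathsf{T}_a:=\{f\mid f(a,\dots,a)=a\}$ for $a\in\{0,1\}$; $\mathsf{T}_c:=\mathsf{T}_0\cap\mathsf{T}_1$; $\mathsf{S}$ is the class of self-dual functions, i.e. those with $f(\overline{\mathbf{a}})=1-f(\mathbf{a})$ for all $\mathbf{a}$, where $\overline{\mathbf{a}}$ is the componentwise negation; $\mathsf{S}_c:=\mathsf{S}\cap\mathsf{T}_c$; $\mathsf{L}:=\mathsf{D}_1$; $\mathsf{L}_0:=\mathsf{L}\cap\mathsf{T}_0$; $\mathsf{L}_1:=\mathsf{L}\cap\mathsf{T}_1$; $\mathsf{LS}:=\mathsf{L}\cap\mathsf{S}$; $\mathsf{L}_c:=\mathsf{L}\cap\mathsf{T}_c$. *)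

(* Defs.v *)
From mathcomp Require Import all_boot all_algebra.
From mathcomp Require Import boolp classical_sets.

Set Implicit Arguments.
Unset Strict Implicit.
Unset Printing Implicit Defensive.

Import GRing.Theory.

Local Open Scope classical_set_scope.

(* A Boolean function of arity at least 1: its arity is [predar.+1]. *)
Record boolfun := BoolFun {
  predar : nat;
  bfun :> {ffun {ffun 'I_predar.+1 -> bool} -> bool}
}.

Definition arity (f : boolfun) : nat := (predar f).+1.

Definition projection (n : nat) (i : 'I_n.+1) : boolfun :=
  BoolFun [ffun x : {ffun 'I_n.+1 -> bool} => x i].

Definition compose (f : boolfun) (m : nat)
    (g : 'I_(arity f) -> {ffun {ffun 'I_m.+1 -> bool} -> bool}) : boolfun :=
  BoolFun [ffun x : {ffun 'I_m.+1 -> bool} => f [ffun i => g i x]].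

Definition class_comp (C K : set boolfun) : set boolfun :=
  [set h | exists (f : boolfun) (m : nat)
       (g : 'I_(arity f) -> {ffun {ffun 'I_m.+1 -> bool} -> bool}),
     [/\ C f, forall i, K (BoolFun (g i)) & h = compose g]].

Infix "`o`" := class_comp (at level 40, left associativity)
  : classical_set_scope.

Definition clone (C : set boolfun) : Prop :=
  (forall (n : nat) (i : 'I_n.+1), C (projection i)) /\ C `o` C `<=` C.

Definition stable (C K : set boolfun) : Prop :=
  K `o` C `<=` K /\ C `o` K `<=` K.

(* The field GF(2) is [bool], whose ring addition is [addb] and whose ring
   multiplication is [andb]. *)
Definition zhegalkin (n : nat) (M : {set {set 'I_n}}) :
    {ffun {ffun 'I_n -> bool} -> bool} :=
  [ffun x : {ffun 'I_n -> bool} => (\sum_(S in M) \prod_(i in S) x i)%R].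

Lemma zhegalkin_ind n (M : {set {set 'I_n}}) (A : {set 'I_n}) :
  zhegalkin M [ffun i => i \in A] = (\sum_(S in M) (S \subset A : bool))%R.
Proof.
rewrite ffunE; apply: eq_bigr => S _.
case: (boolP (S \subset A)) => [/fintype.subsetP sSA | /fintype.subsetPn[i iS iA]].
  by rewrite big1 // => i /sSA iA; rewrite ffunE iA.
by rewrite (bigD1 i) //= ffunE (negbTE iA) mul0r.
Qed.

Lemma zhegalkin_inj n : injective (@zhegalkin n).
Proof.
move=> M N eqMN; apply/finset.setP => A.
have [k] := ubnP #|A|; elim: k A => // k IHk A leAk.
have split (P : {set {set 'I_n}}) :
    zhegalkin P [ffun i => i \in A]
  = ((A \in P) + \sum_(S in P | S \proper A) (1 : bool))%R.
  rewrite zhegalkin_ind (bigID (pred1 A)) /=; congr (_ + _)%R.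
    case: (boolP (A \in P)) => AP.
      rewrite (big_pred1 A) ?subxx // => S.
      by rewrite /= andbC; case: eqP => [->|]; rewrite ?AP.
    rewrite big1 // => S /andP[SP /eqP eqSA].
    by rewrite -eqSA SP in AP.
  rewrite [RHS]big_mkcondr [LHS]big_mkcondr; apply: eq_bigr => S _.
  rewrite finset.properEneq.
  by case: (S == A); case: (S \subset A).
have : zhegalkin M [ffun i => i \in A] = zhegalkin N [ffun i => i \in A].
  by rewrite eqMN.
rewrite !split (eq_bigl (fun S => (S \in N) && (S \proper A))); last first.
  move=> S; case: (boolP (S \proper A)) => SA; rewrite ?andbF // !andbT.
  by apply: IHk; apply: leq_trans (proper_card SA) _.
by move/addIr.
Qed.

Lemma zhegalkin_ex n (f : {ffun {ffun 'I_n -> bool} -> bool}) :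
  exists M, zhegalkin M == f.
Proof.
have [g _ gK] : bijective (@zhegalkin n).
  apply: inj_card_bij; first exact: zhegalkin_inj.
  rewrite !card_ffun card_bool card_ord.
  have setE (T : finType) : #|{set T}| = 2 ^ #|T|.
    by rewrite -(cardsT T) -card_powerset finset.powersetT cardsT.
  by rewrite !setE card_ord.
by exists (g f); rewrite gK.
Qed.

(* The set M_f of the monomials of the Zhegalkin polynomial of f. *)
Definition monomials (n : nat) (f : {ffun {ffun 'I_n -> bool} -> bool}) :
  {set {set 'I_n}} := xchoose (zhegalkin_ex f).

Lemma monomialsP n (f : {ffun {ffun 'I_n -> bool} -> bool})
    (M : {set {set 'I_n}}) :
  (forall x, f x = (\sum_(S in M) \prod_(i in S) x i)%R) <-> M = monomials f.
Proof.
have fE : zhegalkin (monomials f) = f.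
  by apply/eqP; apply: (xchooseP (zhegalkin_ex f)).
split=> [fM | -> x]; last by rewrite -[in LHS]fE ffunE.
by apply: zhegalkin_inj; rewrite fE; apply/ffunP => x; rewrite ffunE fM.
Qed.

(* The maximum of the empty set of naturals is 0, so deg 0 = 0. *)
Definition deg (f : boolfun) : nat := \max_(S in monomials f) #|S|.

Definition cD (k : nat) : set boolfun := [set f | deg f <= k].

Definition ch (f : boolfun) (S : {set 'I_(arity f)}) : nat :=
  #|[pred A in monomials f | S \proper A]| %% 2.

Lemma charrank_ex (f : boolfun) :
  exists m, [forall S : {set 'I_(arity f)}, (m <= #|S|) ==> (ch S == 0)].
Proof.
exists (arity f); apply/forallP => S; apply/implyP => leS.
rewrite /ch eq_card0 // => A; rewrite !inE; apply/negP => /andP[_ /proper_card].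
by rewrite ltnNge (leq_trans _ leS) // -[leqRHS]card_ord max_card.
Qed.

Definition charrank (f : boolfun) : nat := ex_minn (charrank_ex f).

Definition cX (k : nat) : set boolfun := [set f | charrank f <= k].

Definition value_at (f : boolfun) (a : bool) : bool := f [ffun=> a].

Definition Omega : set boolfun := setT.
(* [Omega_l a], [Omega_r b] and [Omega_lr a b] stand for the classes written
   with the subscripts a*, *b and ab. *)
Definition Omega_l (a : bool) : set boolfun := [set f | value_at f false = a].
Definition Omega_r (b : bool) : set boolfun := [set f | value_at f true = b].
Definition Omega_lr (a b : bool) : set boolfun := Omega_l a `&` Omega_r b.
Definition Omega_eq : set boolfun :=
  [set f | value_at f false = value_at f true].
Definition Omega_neq : set boolfun :=
  [set f | value_at f false <> value_at f true].

(* [cT a] is T_a and [cLa a] is L_a; the suffix c of [cTc], [cSc] and [cLc]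
   marks the intersection with T_0 and T_1. *)
Definition cT (a : bool) : set boolfun := [set f | value_at f a = a].
Definition cTc : set boolfun := cT false `&` cT true.
Definition cS : set boolfun :=
  [set f | forall x : {ffun 'I_(arity f) -> bool},
     f [ffun i => ~~ x i] = ~~ f x].
Definition cSc : set boolfun := cS `&` cTc.
Definition cL : set boolfun := cD 1.
Definition cLa (a : bool) : set boolfun := cL `&` cT a.
Definition cLS : set boolfun := cL `&` cS.
Definition cLc : set boolfun := cL `&` cTc.

(* [table K C1 C2] holds when (K, C1, C2) is an instance of a row. *)
Inductive table : set boolfun -> set boolfun -> set boolfun -> Prop :=
| row_Omega : table Omega Omega Omega
| row_Omega_l a : table (Omega_l a) (cT false) (cT a)
| row_Omega_r a : table (Omega_r a) (cT true) (cT a)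
| row_Omega_eq : table Omega_eq cTc Omega
| row_Omega_neq : table Omega_neq cTc cS
| row_Omega_lr a b : table (Omega_lr a b) cTc (cT a `&` cT b)

| row_X k : 2 <= k -> table (cX k) cLS cL
| row_X1 : table (cX 1) cS cL
| row_X_l k a : 2 <= k -> table (cX k `&` Omega_l a) cLc (cLa a)
| row_X1_l a : table (cX 1 `&` Omega_l a) cSc (cLa a)
| row_X_r k a : 2 <= k -> table (cX k `&` Omega_r a) cLc (cLa a)
| row_X1_r a : table (cX 1 `&` Omega_r a) cSc (cLa a)
| row_X_eq k : 2 <= k -> table (cX k `&` Omega_eq) cLc cL
| row_X1_eq : table (cX 1 `&` Omega_eq) cS Omega
| row_X_neq k : 2 <= k -> table (cX k `&` Omega_neq) cLc cLS
| row_X1_neq : table (cX 1 `&` Omega_neq) cS cS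
| row_X_lr k a b : 2 <= k -> table (cX k `&` Omega_lr a b) cLc (cLa a `&` cLa b)
| row_X1_lr_eq a b : a = b -> table (cX 1 `&` Omega_lr a b) cSc (cT a)
| row_X1_lr_neq a b : a <> b -> table (cX 1 `&` Omega_lr a b) cSc cSc

| row_D k : 1 <= k -> table (cD k) cL cL
| row_D_l k a : 1 <= k -> table (cD k `&` Omega_l a) (cLa false) (cLa a)
| row_D_r k a : 1 <= k -> table (cD k `&` Omega_r a) (cLa true) (cLa a)
| row_D_eq k : 2 <= k -> table (cD k `&` Omega_eq) cLc cL
| row_D1_eq : table (cD 1 `&` Omega_eq) cLS cL
| row_D_neq k : 2 <= k -> table (cD k `&` Omega_neq) cLc cLS
| row_D1_neq : table (cD 1 `&` Omega_neq) cLS cLS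
| row_D_lr k a b : 1 <= k -> table (cD k `&` Omega_lr a b) cLc (cLa a `&` cLa b)

| row_DX i j : 1 <= j < i -> table (cD i `&` cX j) cLS cL
| row_DX_l i j a :
    1 <= j < i -> table (cD i `&` cX j `&` Omega_l a) cLc (cLa a)
| row_DX_r i j a :
    1 <= j < i -> table (cD i `&` cX j `&` Omega_r a) cLc (cLa a)
| row_DX_eq i j :
    2 <= j < i -> table (cD i `&` cX j `&` Omega_eq) cLc cL
| row_DX1_eq i : 2 <= i -> table (cD i `&` cX 1 `&` Omega_eq) cLS cL
| row_DX_neq i j :
    2 <= j < i -> table (cD i `&` cX j `&` Omega_neq) cLc cLS
| row_DX1_neq i : 2 <= i -> table (cD i `&` cX 1 `&` Omega_neq) cLS cLS
| row_DX_lr i j a b :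
    1 <= j < i -> table (cD i `&` cX j `&` Omega_lr a b) cLc (cLa a `&` cLa b)

| row_D0 : table (cD 0) Omega Omega
| row_D0_l a : table (cD 0 `&` Omega_l a) Omega (cT a)
| row_empty : table set0 Omega Omega.

Definition stability_clones (K C1 C2 : set boolfun) : Prop :=
  [/\ clone C1, clone C2
    & forall C, clone C ->
        (K `o` C `<=` K <-> C `<=` C1) /\ (C `o` K `<=` K <-> C `<=` C2)].

(* Main.v *)
(* Over GF(2) write f(x) as the sum over S of
   (c_S + d_S x_0) prod_(i in S) (x_i + x_0), where x_0 is a fixed variable. Here
   c_S is the Zhegalkin coefficient of S in f, and d_S = ch(S, f) is that of
   f(x) + f(~x); hence deg f <= p reads c_S = 0 for |S| > p, and chi(f) <= q + 1
   reads d_S = 0 for |S| > q. If K is L_c-stable and f is in K, summing the 2^|S|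
   minors of f that send each variable of S to itself or to x_0 shows that the
   term of S may be added to any member of K. So K is determined by the largest
   |S| with c_S <> 0, by the largest |S| with d_S <> 0, and by the set of pairs
   (f(0), f(1)), an affine subspace of GF(2)^2; this gives the list of classes.
   The maximality of the two clones is proved with explicit members of K made of
   one such term: substituting a function outside of the expected clone into
   them, or them into it, produces a term that is too large, or wrong values at
   the constant points. *)
Require Import Defs.
From mathcomp Require Import all_boot all_algebra.
From mathcomp Require Import boolp classical_sets.

Set Implicit Arguments.
Unset Strict Implicit.
Unset Printing Implicit Defensive.

Local Open Scope classical_set_scope.

Local Notation pt n := {ffun 'I_n.+1 -> bool}.

(** Functions of L_c are harmless to substitute because they fix both constant points and commute
    with complementation: f(0), f(1) and f(x) + f(~x) can each be followed through the composition.
    The numbers c_S and d_S are not independent. Since d_S counts strict supersets of S among the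
    monomials, d_S = 1 forces c_A = 1 for some larger A, so the bounds form pairs (p, q) with q < p:
    D_k is (k, k-1), and X_k is the rank bound k-1 with the degree unbounded. The irregular rows
    come from the borders of this range. If p = q + 1, the rank bound follows from the degree bound
    and does not force inner functions to be self-dual. If q = 0 and the degree is unbounded, f(x) +
    f(~x) is constant on each member, nonlinear substitutions become possible, and no term with d_S
    = 1 is available as a test, so other members of K have to be found. A further obstacle is that K
    is closed under sums of three members but not of two: whatever is added to a member must be a
    sum of an even number of minors. Only terms with S nonempty are obtained in this way; the rest
    of f is a unary function carrying f(0) and f(1). *)

Definition ind n (T : {set 'I_n.+1}) : pt n := [ffun i => i \in T].
Definition compl n (x : pt n) : pt n := [ffun i => ~~ x i].
Definition der n (h : pt n -> bool) (x : pt n) : bool := h x (+) h (compl x).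
(** Moebius inversion modulo 2: this is the Zhegalkin coefficient of S (see [coef_monomials]),
    written through values so that it is visibly additive in [h]. *)
Definition coef n (h : pt n -> bool) (S : {set 'I_n.+1}) : bool :=
  \big[addb/false]_(T in powerset S) h (ind T).
Definition degle n d (h : pt n -> bool) : Prop :=
  forall S : {set 'I_n.+1}, d < #|S| -> coef h S = false.
(* Membership of a function that is not packed as a [boolfun]. *)
Definition inc (K : set boolfun) n (h : pt n -> bool) : Prop :=
  K (BoolFun [ffun x => h x]).

(** * Sums over subsets and Zhegalkin coefficients *)

Lemma powerset_setU1 (I : finType) (G : {set I} -> bool) (S : {set I}) i : i \in S ->
  \big[addb/false]_(T in powerset S) G T
  = \big[addb/false]_(T in powerset (S :\ i)%SET) (G T (+) G (i |: T)%SET).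
Proof.
move=> iS; rewrite (bigID (fun T : {set I} => i \in T)) /= addbC big_split /=.
congr (_ (+) _).
  by apply: eq_bigl => T; rewrite !powersetE finset.subsetD1.
rewrite (reindex_onto (fun T : {set I} => i |: T)%SET
  (fun T : {set I} => T :\ i)%SET) /=; last first.
  by move=> T /andP[_ iT]; rewrite finset.setD1K.
apply: eq_bigl => T; rewrite !powersetE finset.subUset finset.sub1set iS /=.
rewrite finset.setU11 andbT finset.subsetD1; congr (_ && _).
apply/eqP/idP => [<-|iT]; first by rewrite finset.setD11.
by apply: finset.setU1K.
Qed.

(** Pairing T with T + {i} cancels the sum modulo 2. This is the usual way below to show that a
    coefficient vanishes: find a variable of S that is ignored. *)
Lemma powerset_cancel (I : finType) (G : {set I} -> bool) (S : {set I}) i : i \in S ->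
  (forall T : {set I}, T \subset S -> i \notin T -> G (i |: T)%SET = G T) ->
  \big[addb/false]_(T in powerset S) G T = false.
Proof.
move=> iS GE; rewrite (powerset_setU1 _ iS) big1 // => T.
rewrite powersetE finset.subsetD1 => /andP[TS iT].
by rewrite GE // addbb.
Qed.

Lemma powerset_top (I : finType) (G : {set I} -> bool) (S : {set I}) :
  (forall T : {set I}, T \subset S -> T != S -> G T = false) ->
  \big[addb/false]_(T in powerset S) G T = G S.
Proof.
move=> G0; rewrite (bigD1 S) /=; last by rewrite powersetE.
by rewrite big1 ?addbF // => T /andP[]; rewrite powersetE; apply: G0.
Qed.

Lemma eq_coef n (h h' : pt n -> bool) : h =1 h' -> coef h =1 coef h'.
Proof. by move=> hE S; apply: eq_bigr => T _; rewrite hE. Qed.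

Lemma eq_der n (h h' : pt n -> bool) : h =1 h' -> der h =1 der h'.
Proof. by move=> hE x; rewrite /der !hE. Qed.

Lemma coef_addb n (h h' : pt n -> bool) S :
  coef (fun x => h x (+) h' x) S = coef h S (+) coef h' S.
Proof. exact: big_split. Qed.

Lemma monoE n (f : {ffun pt n -> bool}) (T : {set 'I_n.+1}) :
  f (ind T) = \big[addb/false]_(S in monomials f) (S \subset T).
Proof.
have /monomialsP /(_ (ind T)) -> := erefl (monomials f).
rewrite -[RHS]/(\sum_(S in monomials f) (S \subset T : bool))%R.
by rewrite -zhegalkin_ind ffunE.
Qed.

(** After exchanging the sums, a monomial A contributes the number of sets between A and S modulo 2,
    which is odd only for A = S. *)
Lemma coef_monomials n (f : {ffun pt n -> bool}) (S : {set 'I_n.+1}) :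
  coef f S = (S \in monomials f).
Proof.
rewrite /coef; under eq_bigr => T _ do rewrite monoE.
rewrite exchange_big /=.
have E (A : {set 'I_n.+1}) : A != S -> \big[addb/false]_(T in powerset S) (A \subset T) = false.
  move=> AS; case: (boolP (A \subset S)) => [sAS|nAS]; last first.
    rewrite big1 // => T; rewrite powersetE => TS; apply/negbTE.
    by apply: contra nAS => /fintype.subset_trans; apply.
  have /fintype.subsetPn[i iS iA] : ~~ (S \subset A).
    by apply: contra AS => sSA; rewrite finset.eqEsubset sAS.
  apply: (powerset_cancel iS) => T _ _.
  have AE : (A :\ i)%SET = A.
    by apply/finset.setDidPl; rewrite disjoint_sym disjoints1.
  by rewrite -finset.subDset AE.
rewrite (bigID (pred1 S)) /= addbC big1 => [|A /andP[_]]; last exact: E.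
case: (boolP (S \in monomials f)) => SM; last first.
  rewrite big1 // => A /andP[AM /eqP AS].
  by rewrite AS (negbTE SM) in AM.
rewrite (big_pred1 S) => [|A /=]; last first.
  by rewrite andbC; case: eqP => // ->.
rewrite powerset_top ?fintype.subxx // => T TS.
by apply: contraNF => ST; rewrite finset.eqEsubset TS.
Qed.

Lemma compl_ind n (T : {set 'I_n.+1}) : compl (ind T) = ind (~: T)%SET.
Proof. by apply/ffunP => i; rewrite !ffunE finset.in_setC. Qed.

Lemma complK n : involutive (@compl n).
Proof. by move=> x; apply/ffunP => i; rewrite !ffunE negbK. Qed.

Lemma ind_supp n (x : pt n) : x = ind [set i | x i]%SET.
Proof. by apply/ffunP => i; rewrite !ffunE finset.inE. Qed.

(* Both sides count, modulo 2, the monomials that strictly contain S: flipping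
   all variables of a monomial A gives the sum of all monomials inside A. *)
Lemma coef_der n (f : {ffun pt n -> bool}) (S : {set 'I_n.+1}) :
  coef (der f) S = odd #|[pred A in monomials f | S \proper A]|.
Proof.
have E (A : {set 'I_n.+1}) :
    \big[addb/false]_(T in powerset S) (A \subset ~: T)%SET = (S \subset A).
  case: (boolP (S \subset A)) => [sSA|/fintype.subsetPn[i iS iA]]; last first.
    apply: (powerset_cancel iS) => T _ _.
    rewrite finset.setCU finset.subsetI finset.subsetC.
    by rewrite finset.sub1set finset.in_setC iA.
  rewrite (bigD1 finset.set0) ?powersetE ?finset.sub0set //=.
  rewrite finset.setC0 finset.subsetT big1 // => T /andP[].
  rewrite powersetE => TS /finset.set0Pn[i iT]; apply/negbTE/fintype.subsetPn.
  exists i; first by apply: (fintype.subsetP sSA); apply: (fintype.subsetP TS).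
  by rewrite finset.in_setC negbK.
rewrite /der coef_addb coef_monomials /coef.
under eq_bigr => T _ do rewrite compl_ind monoE.
rewrite exchange_big /=; under eq_bigr => A _ do rewrite E.
rewrite -sum1_card (big_morph odd oddD (erefl : odd 0 = false)).
rewrite (eq_bigr (fun A => (A == S) (+) (S \proper A))); last first.
  move=> A _; rewrite finset.properEneq eq_sym.
  by case: eqP => [->|]; rewrite ?fintype.subxx.
rewrite big_split /= addbA.
set s := \big[addb/false]_(i in _) (i == S).
have -> : s = (S \in monomials f).
  rewrite /s; case: (boolP (S \in monomials f)) => SM.
    rewrite (bigD1 S) //= eqxx big1 // => A /andP[_ /negbTE //].
  by rewrite big1 // => A AM; apply: contraNF SM => /eqP <-.
rewrite addbb addFb [RHS]big_mkcond [LHS]big_mkcond.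
by apply: eq_bigr => A _ /=; rewrite inE; case: (A \in monomials f) => //=; case: (S \proper A).
Qed.

(** * Membership of unpacked functions and calculus of degrees *)

Lemma incP (K : set boolfun) (f : boolfun) : K f <-> inc K f.
Proof. by rewrite /inc ffunK; case: f. Qed.

Lemma inc_ext (K : set boolfun) n (h h' : pt n -> bool) :
  h =1 h' -> inc K h -> inc K h'.
Proof. by move=> hE; rewrite /inc (eq_ffun h' hE). Qed.

Lemma coef_ffun n (h : pt n -> bool) : coef [ffun x => h x] =1 coef h.
Proof. by apply: eq_coef => x; rewrite ffunE. Qed.

Lemma coef_der_ffun n (h : pt n -> bool) : coef (der [ffun x => h x]) =1 coef (der h).
Proof. by apply: eq_coef; apply: eq_der => x; rewrite ffunE. Qed.

Lemma inc_cD k n (h : pt n -> bool) : inc (cD k) h <-> degle k h.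
Proof.
rewrite /inc /cD /deg /=; split=> [/bigmax_leqP hk S kS|hk].
  rewrite -coef_ffun coef_monomials; apply/negP => /hk.
  by rewrite leqNgt kS.
apply/bigmax_leqP => S; rewrite -coef_monomials coef_ffun leqNgt.
by move=> hS; apply/negP => /hk; rewrite hS.
Qed.

Lemma inc_cX k n (h : pt n -> bool) : inc (cX k) h <->
  forall S : {set 'I_n.+1}, k <= #|S| -> coef (der h) S = false.
Proof.
rewrite /inc /cX /charrank /=; case: ex_minnP => m /forallP mP mmin.
have chE S : (@ch (BoolFun [ffun x => h x]) S == 0) = ~~ coef (der h) S.
  by rewrite /ch modn2 eqb0 -coef_der_ffun coef_der.
split=> [mk S kS|hk].
  by apply/negbTE; move: (mP S); rewrite chE (leq_trans mk kS).
apply: mmin; apply/forallP => S; apply/implyP => kS.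
by rewrite chE; apply/negbT/hk.
Qed.

Lemma inc_cX_degle k n (h : pt n -> bool) :
  inc (cX k.+1) h <-> degle k (der h).
Proof. exact: inc_cX. Qed.

Lemma moebius n (h : pt n -> bool) x :
  h x = \big[addb/false]_(S : {set 'I_n.+1}) (coef h S && [forall i in S, x i]).
Proof.
have := monoE [ffun y => h y] [set i | x i]%SET.
rewrite -ind_supp ffunE => ->; rewrite big_mkcond /=; apply: eq_bigr => S _.
rewrite -coef_ffun coef_monomials; case: (_ \in _) => //=.
by apply/fintype.subsetP/'forall_implyP => xS i /xS; rewrite finset.inE.
Qed.

Lemma degle_ext d n (h h' : pt n -> bool) : h =1 h' -> degle d h -> degle d h'.
Proof. by move=> hE dh S dS; rewrite -(eq_coef hE) dh. Qed.

Lemma degle_le d d' n (h : pt n -> bool) : d <= d' -> degle d h -> degle d' h.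
Proof. by move=> dd dh S dS; apply: dh; apply: leq_ltn_trans dS. Qed.

Lemma degleD d n (h h' : pt n -> bool) :
  degle d h -> degle d h' -> degle d (fun x => h x (+) h' x).
Proof. by move=> dh dh' S dS; rewrite coef_addb dh ?dh'. Qed.

Lemma degle_const d n c : degle d (fun _ : pt n => c).
Proof.
move=> S dS; have [i iS] : exists i, i \in S by apply/card_gt0P/(leq_trans _ dS).
exact: (powerset_cancel iS).
Qed.
Arguments degle_const [d n] c.

Lemma degle0 n (h : pt n -> bool) : degle 0 h -> forall x y, h x = h y.
Proof.
move=> dh; suff E x : h x = coef h finset.set0 by move=> x y; rewrite !E.
rewrite moebius (bigD1 finset.set0) //= big1 ?addbF; last first.
  by move=> S S0; rewrite dh // card_gt0.
rewrite [X in _ && X](_ : _ = true) ?andbT //.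
by apply/forallP => i; rewrite finset.in_set0.
Qed.

(** Stated for any additive predicate, because it serves both degree bounds and the set of functions
    that may be added to every member of a class. *)
Lemma addclosed_sum n (X : (pt n -> bool) -> Prop) (I : Type) (r : seq I)
    (P : pred I) (F : I -> pt n -> bool) :
  X (fun=> false) -> (forall h k, X h -> X k -> X (fun x => h x (+) k x)) ->
  (forall i, P i -> X (F i)) ->
  X (fun x => \big[addb/false]_(i <- r | P i) F i x).
Proof.
move=> X0 XD XF; elim: r => [|i r IHr].
  by rewrite (_ : (fun x => _) = fun=> false) //; apply: funext => x; rewrite big_nil.
have [Pi|nPi] := boolP (P i).
  rewrite (_ : (fun x => _) = fun x => F i x (+) \big[addb/false]_(j <- r | P j) F j x).
    exact: XD (XF i Pi) IHr.
  by apply: funext => x; rewrite big_cons Pi.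
rewrite (_ : (fun x => _) = fun x => \big[addb/false]_(j <- r | P j) F j x) //.
by apply: funext => x; rewrite big_cons (negbTE nPi).
Qed.

Lemma degle_sum d n (I : Type) (r : seq I) (P : pred I) (F : I -> pt n -> bool) :
  (forall i, P i -> degle d (F i)) ->
  degle d (fun x => \big[addb/false]_(i <- r | P i) F i x).
Proof. exact: addclosed_sum (degle_const false) (@degleD d n). Qed.

(** For i in S the coefficient of x_i h at S is c_S + c_(S - i), and both sets have more than d
    elements. *)
Lemma degle_mulx d n (h : pt n -> bool) i :
  degle d h -> degle d.+1 (fun x => x i && h x).
Proof.
move=> dh S dS; case: (boolP (i \in S)) => [iS|niS]; last first.
  rewrite /coef big1 // => T; rewrite powersetE ffunE => /fintype.subsetP TS.
  by case: (boolP (i \in T)) => // /TS; rewrite (negbTE niS).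
have dS' : d < #|(S :\ i)%SET|.
  by move: dS; rewrite (finset.cardsD1 i) iS.
rewrite /coef (powerset_setU1 _ iS) /=.
have := dh S (ltnW dS); rewrite /coef (powerset_setU1 _ iS) big_split /=.
rewrite -/(coef h _) dh //= => hS; apply: etrans hS.
apply: eq_bigr => T; rewrite powersetE finset.subsetD1 => /andP[_ iT].
by rewrite !ffunE (negbTE iT) finset.setU11.
Qed.

Lemma degleM d e n (h k : pt n -> bool) :
  degle d h -> degle e k -> degle (d + e) (fun x => h x && k x).
Proof.
move=> dh ek.
have mono s : degle (size s + e) (fun x => all x s && k x).
  elim: s => [|i s IHs] //=.
  by apply: (degle_ext _ (degle_mulx i IHs)) => x; rewrite andbA.
pose t (S : {set 'I_n.+1}) (x : pt n) := coef h S && (all x (enum S) && k x).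
have tE x : \big[addb/false]_S t S x = (h x && k x).
  rewrite [in RHS]moebius big_distrl; apply: eq_bigr => S _ /=.
  rewrite /t andbA; congr (_ && _ && _).
  apply/allP/'forall_implyP => xS i; first by move=> iS; apply: xS; rewrite mem_enum.
  by rewrite mem_enum; apply: xS.
apply: (degle_ext tE); apply: degle_sum => S _.
rewrite /t; case: (boolP (coef h S)) => hS; last exact: degle_const.
apply: (degle_le _ (mono (enum S))); rewrite leq_add2r -cardE leqNgt.
by apply: contraL hS => /dh ->.
Qed.

Lemma degle_all d n (I : eqType) (s : seq I) (g : I -> pt n -> bool) :
  (forall i, i \in s -> degle d (g i)) ->
  degle (size s * d) (fun x => all (g^~ x) s).
Proof.
elim: s => [|i s IHs] dg /=; first exact: degle_const.
by rewrite mulSn; apply: degleM; [apply: dg|apply: IHs => j js; apply: dg];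
  rewrite inE ?eqxx ?js ?orbT.
Qed.

Lemma degle_comp d e n m (f : pt n -> bool) (g : 'I_n.+1 -> pt m -> bool) :
  degle d f -> (forall i, degle e (g i)) ->
  degle (d * e) (fun x => f [ffun i => g i x]).
Proof.
move=> df dg.
pose t (S : {set 'I_n.+1}) (x : pt m) := coef f S && all (g^~ x) (enum S).
apply: (@degle_ext _ _ (fun x => \big[addb/false]_S t S x)) => [x|].
  rewrite [in RHS]moebius; apply: eq_bigr => S _; congr (_ && _).
  apply/allP/'forall_implyP => xS i; rewrite ?ffunE.
    by move=> iS; apply: xS; rewrite mem_enum.
  by rewrite mem_enum => /xS; rewrite ffunE.
apply: degle_sum => S _; rewrite /t.
case: (boolP (coef f S)) => fS; last exact: degle_const.
apply: (degle_le _ (degle_all (s := enum S) (fun i _ => dg i))).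
rewrite leq_mul2r -cardE; apply/orP; right; rewrite leqNgt.
by apply: contraL fS => /df ->.
Qed.

Lemma degle_proj n i : degle 1 (fun x : pt n => x i).
Proof.
by apply: (degle_ext _ (degle_mulx i (degle_const (d := 0) true))) => x; rewrite andbT.
Qed.

Lemma inc_comp (G R K : set boolfun) n m (f : pt n -> bool)
    (A : 'I_n.+1 -> pt m -> bool) :
  G `o` R `<=` K -> inc G f -> (forall i, inc R (A i)) ->
  inc K (fun x => f [ffun i => A i x]).
Proof.
move=> GRK Gf RA; apply: GRK.
exists (BoolFun [ffun x => f x]), m, (fun i => [ffun x => A i x]).
split=> //; rewrite /compose; congr BoolFun; apply/ffunP => x.
by rewrite !ffunE; congr f; apply/ffunP => i; rewrite !ffunE.
Qed.

Lemma sub_comp (G R K : set boolfun) :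
  (forall n m (f : pt n -> bool) (A : 'I_n.+1 -> pt m -> bool),
    inc G f -> (forall i, inc R (A i)) -> inc K (fun x => f [ffun i => A i x])) ->
  G `o` R `<=` K.
Proof.
move=> GRK h [f [m [g [Gf Rg ->]]]]; rewrite /compose.
have -> : [ffun x : pt m => f [ffun i => g i x]] =
    [ffun x => (fun y => f [ffun i => (fun i x => g i x) i y]) x].
  by apply/ffunP => x; rewrite !ffunE.
by apply: GRK => [|i]; [apply: (iffLR (incP G f))|apply: (iffLR (incP _ _) (Rg i))].
Qed.

Lemma inc_setI (K K' : set boolfun) n (h : pt n -> bool) :
  inc (K `&` K') h <-> inc K h /\ inc K' h.
Proof. exact: iff_refl. Qed.

Local Notation cst b := [ffun=> b].

Lemma inc_cT a n (h : pt n -> bool) : inc (cT a) h <-> h (cst a) = a.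
Proof. by rewrite /inc /cT /value_at /= ffunE. Qed.

Lemma inc_cTc n (h : pt n -> bool) :
  inc cTc h <-> h (cst false) = false /\ h (cst true) = true.
Proof. by rewrite inc_setI !inc_cT. Qed.

Lemma inc_cS n (h : pt n -> bool) :
  inc cS h <-> forall x, h (compl x) = ~~ h x.
Proof. split=> hS x; have := hS x; rewrite /bfun !ffunE; exact. Qed.

Lemma inc_cS_der n (h : pt n -> bool) : inc cS h <-> forall x, der h x = true.
Proof.
rewrite inc_cS; split=> hS x; move: (hS x); rewrite /der.
  by move=> ->; rewrite addbN addbb.
by case: (h x) (h (compl x)) => -[].
Qed.

Lemma compl_cst n b : compl (cst b) = cst (~~ b) :> pt n.
Proof. by apply/ffunP => i; rewrite !ffunE. Qed.

Lemma compl_comp n m (A : 'I_n.+1 -> pt m -> bool) x :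
  (forall i, inc cS (A i)) ->
  [ffun i => A i (compl x)] = compl [ffun i => A i x].
Proof.
by move=> AS; apply/ffunP => i; rewrite !ffunE (inc_cS (A i)).1.
Qed.

Lemma cst_comp n m (A : 'I_n.+1 -> pt m -> bool) b c :
  (forall i, A i (cst b) = c) -> [ffun i => A i (cst b)] = cst c.
Proof. by move=> Ab; apply/ffunP => i; rewrite !ffunE. Qed.

Lemma derD n (h k : pt n -> bool) :
  der (fun x => h x (+) k x) =1 fun x => der h x (+) der k x.
Proof. by move=> x; rewrite /der addbACA. Qed.

Lemma der_comp n m (f : pt n -> bool) (A : 'I_n.+1 -> pt m -> bool) :
  (forall i, inc cS (A i)) ->
  der (fun x => f [ffun i => A i x]) =1 fun x => der f [ffun i => A i x].
Proof. by move=> AS x; rewrite /der compl_comp. Qed.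

Lemma degle_der d n (h : pt n -> bool) : degle d.+1 h -> degle d (der h).
Proof.
move=> dh S dS; rewrite -coef_der_ffun coef_der eq_card0 // => A.
apply/negbTE; rewrite inE -coef_monomials coef_ffun negb_and.
case: (boolP (S \proper A)) => [/proper_card SA|_]; last by rewrite orbT.
by rewrite dh //; apply: leq_ltn_trans SA.
Qed.

Lemma degle1_der n (h : pt n -> bool) x y : degle 1 h -> der h x = der h y.
Proof. by move/degle_der/degle0; apply. Qed.

(** An affine function has a constant derivative, and the values 0 and 1 at the constant points make
    that constant 1. *)
Lemma cLc_sub_cS n (h : pt n -> bool) : inc cLc h -> inc cS h.
Proof.
move=> [/inc_cD hL /inc_cTc [h0 h1]]; apply/inc_cS_der => x.
by rewrite (degle1_der _ (cst false) hL) /der compl_cst h0 h1.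
Qed.

Lemma inc_cLc_proj n i : inc cLc (fun x : pt n => x i).
Proof.
split; first exact/inc_cD/degle_proj.
by apply/inc_cTc; rewrite !ffunE.
Qed.

(** * Sums of three members, extraction and absorption of a single term *)

Definition xor3_closed (K : set boolfun) := forall n (a b c : pt n -> bool),
  inc K a -> inc K b -> inc K c -> inc K (fun x => a x (+) (b x (+) c x)).

Lemma cLc_xor3 : xor3_closed cLc.
Proof.
move=> n a b c [/inc_cD aL /inc_cTc [a0 a1]] [/inc_cD bL /inc_cTc [b0 b1]]
  [/inc_cD cL /inc_cTc [c0 c1]].
split; first exact/inc_cD/degleD/degleD.
by apply/inc_cTc; rewrite a0 a1 b0 b1 c0 c1.
Qed.

(** The function x + y + z belongs to L_c. This closure is the form in which stability on the left
    is used from here on. *)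
Lemma xor3_stable K : cLc `o` K `<=` K -> xor3_closed K.
Proof.
move=> LK n a b c Ka Kb Kc.
pose A (i : 'I_3) := if i == 0 :> nat then a else if i == 1 :> nat then b else c.
pose f (y : pt 2) := y (inord 0) (+) (y (inord 1) (+) y (inord 2)).
have Lf : inc cLc f by apply: cLc_xor3; apply: inc_cLc_proj.
have KA i : inc K (A i) by rewrite /A; case: ifP => // _; case: ifP.
apply: inc_ext (inc_comp LK Lf KA) => x.
by rewrite /f !ffunE /A !inordK.
Qed.

(* (a + b v_0) prod_(1 <= i <= d) (v_i + v_0), in variables indexed by nat so that
   it can be substituted into at any arity. *)
Definition mon d a b (v : nat -> bool) : bool :=
  [forall i : 'I_d, v i.+1 (+) v 0] && (a (+) (b && v 0)).

Section Extract.
Variables (n m : nat) (f : pt n -> bool) (S : {set 'I_n.+1}) (A : nat -> pt m -> bool).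

Definition minor_at (T : {set 'I_n.+1}) (x : pt m) : pt n :=
  [ffun i => A (if i \in T then (index i (enum S)).+1 else 0) x].

(* Summing f over all the ways of replacing each variable of S either by its own
   fresh variable or by a common variable v_0 isolates, as a function of v, the
   coefficient of S in f (where v_0 = 0) and in f o compl (where v_0 = 1). *)
Lemma sum_minors x :
  \big[addb/false]_(T in powerset S) f (minor_at T x)
  = mon #|S| (coef f S) (coef (der f) S) (fun j => A j x).
Proof.
have idx i : i \in S -> index i (enum S) < #|S|.
  by move=> iS; rewrite cardE index_mem mem_enum.
case: (boolP [forall i in S, A (index i (enum S)).+1 x (+) A 0 x]) => [all1|].
  have {}all1 i : i \in S -> A (index i (enum S)).+1 x = ~~ A 0 x.
    by move=> iS; move/'forall_implyP: all1 => /(_ i iS); case: (A 0 x) (A _ x) => -[].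
  have mS : [forall i : 'I_#|S|, A i.+1 x (+) A 0 x].
    apply/forallP => i.
    have iS : i < size (enum S) by rewrite -cardE.
    have [i0 _] : exists i0, i0 \in S by apply/card_gt0P; apply: leq_ltn_trans (ltn_ord i).
    have := all1 (nth i0 (enum S) i); rewrite -mem_enum mem_nth // => /(_ isT).
    by rewrite index_uniq ?enum_uniq // => ->; case: (A 0 x).
  rewrite /mon mS /=.
  have selE T : T \in powerset S ->
      f (minor_at T x) = f (ind T) (+) (der f (ind T) && A 0 x).
    rewrite powersetE => /fintype.subsetP TS.
    have -> : minor_at T x = if A 0 x then compl (ind T) else ind T.
      apply/ffunP => i; rewrite ffunE; case: ifP => [iT|niT].
        by rewrite all1 ?TS //; case: (A 0 x); rewrite !ffunE ?iT.
      by case: (A 0 x); rewrite !ffunE ?niT.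
    rewrite /der; case: (A 0 x); last by rewrite andbF addbF.
    by rewrite andbT addbA addbb.
  by rewrite (eq_bigr _ selE) big_split /= -big_distrl.
rewrite negb_forall => /existsP[i]; rewrite negb_imply => /andP[iS iA].
have Ai : A (index i (enum S)).+1 x = A 0 x.
  by move: iA; case: (A 0 x) (A _ x) => -[].
rewrite /mon; have /negbTE-> /= : ~~ [forall i : 'I_#|S|, A i.+1 x (+) A 0 x].
  by rewrite negb_forall; apply/existsP; exists (Ordinal (idx i iS)).
apply: (powerset_cancel iS) => T TS iT; congr f.
apply/ffunP => j; rewrite !ffunE finset.in_setU1.
by case: eqP => [->|//]; rewrite (negbTE iT) Ai.
Qed.

(** [X] is only known to hold for sums of two minors. Choosing i in S and pairing T with T + {i}
    groups the 2^|S| minors into such sums, hence the condition that S is nonempty. *)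
Lemma extract (X : (pt m -> bool) -> Prop) : 0 < #|S| ->
  X (fun=> false) -> (forall h k, X h -> X k -> X (fun x => h x (+) k x)) ->
  (forall T T', X (fun x => f (minor_at T x) (+) f (minor_at T' x))) ->
  X (fun x => mon #|S| (coef f S) (coef (der f) S) (fun j => A j x)).
Proof.
move=> /card_gt0P[i iS] X0 XD Xf.
rewrite (_ : (fun x => _) = fun x => \big[addb/false]_(T in powerset (S :\ i)%SET)
    (f (minor_at T x) (+) f (minor_at (i |: T)%SET x))).
  exact: addclosed_sum.
apply: funext => x.
by rewrite -sum_minors (powerset_setU1 _ iS).
Qed.

End Extract.

(** Two instances matter: [R] is L_c when an L_c-stable class is classified, and [R] is K itself
    when functions are composed with members of K from the left. *)
Definition absorbs (R K : set boolfun) (h : (nat -> bool) -> bool) :=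
  forall m (A : nat -> pt m -> bool) k, (forall j, inc R (A j)) -> inc K k ->
    inc K (fun x => k x (+) h (fun j => A j x)).

Section Absorbs.
Variables (R K G : set boolfun).
Hypotheses (R3 : xor3_closed R) (K3 : xor3_closed K) (GRK : G `o` R `<=` K).

Lemma absorbsD h1 h2 :
  absorbs R K h1 -> absorbs R K h2 -> absorbs R K (fun v => h1 v (+) h2 v).
Proof.
move=> V1 V2 m A k RA Kk.
by apply: inc_ext (V2 _ _ _ RA (V1 _ _ _ RA Kk)) => x; rewrite addbA.
Qed.

Lemma absorbs_extract n (f : pt n -> bool) (S : {set 'I_n.+1}) :
  inc G f -> 0 < #|S| -> absorbs R K (mon #|S| (coef f S) (coef (der f) S)).
Proof.
move=> Gf S0 m A k RA; move: k.
apply: (@extract _ _ f S A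
  (fun t => forall k : pt m -> bool, inc K k -> inc K (fun x => k x (+) t x))) => //.
- by move=> k; apply: inc_ext => x; rewrite addbF.
- by move=> h h' Xh Xh' k Kk; apply: inc_ext (Xh' _ (Xh _ Kk)) => x; rewrite addbA.
move=> T T' k Kk; apply: K3 => //; apply: inc_comp GRK Gf _ => i; exact: RA.
Qed.

Lemma absorbs_shrink d d' a b : 0 < d' <= d ->
  absorbs R K (mon d a b) -> absorbs R K (mon d' a b).
Proof.
move=> /andP[d0 dd] Vd m A k RA Kk.
(* All variables beyond v_(d') are identified with v_(d'). As d' > 0, none is identified with v_0,
   which would annihilate the product. *)
apply: inc_ext (Vd m (fun j => A (minn j d')) k (fun j => RA _) Kk) => x.
congr (_ (+) _); rewrite /mon min0n; congr (_ && _).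
apply/forallP/forallP => [Ad i|Ad i].
  by have := Ad (widen_ord dd i); rewrite /= (minn_idPl (ltn_ord i)).
have lt : (minn i.+1 d').-1 < d' by rewrite prednK ?leq_min ?d0 // geq_minr.
by have := Ad (Ordinal lt); rewrite prednK ?leq_min ?d0.
Qed.

(** Replacing v_0 by v_(d+1) and each v_j by v_j + v_0 + v_(d+1) leaves the factors v_j + v_0
    unchanged. The original term plus the new one is therefore the same product times v_0 + v_(d+1),
    a term with one factor more. *)
Lemma absorbs_raise d a :
  absorbs R K (mon d a true) -> absorbs R K (mon d.+1 true false).
Proof.
move=> Vd m A k RA Kk.
pose B j := if j is j'.+1 then fun x => A j x (+) (A 0 x (+) A d.+1 x) else A d.+1.
have RB j : inc R (B j) by case: j => [|j]; [apply: RA|apply: R3].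
apply: inc_ext (Vd m B _ RB (Vd m A k RA Kk)) => x.
rewrite -addbA; congr (_ (+) _); rewrite /mon /=.
set P := [forall i : 'I_d, A i.+1 x (+) A 0 x].
have -> : [forall i : 'I_d, A i.+1 x (+) (A 0 x (+) A d.+1 x) (+) A d.+1 x] = P.
  by apply: eq_forallb => i; case: (A d.+1 x) (A _ x) (A 0 x) => -[] [].
have -> : [forall i : 'I_d.+1, A i.+1 x (+) A 0 x] = P && (A d.+1 x (+) A 0 x).
  apply/forallP/andP => [AP|[/forallP AP Ad] i].
    split; first by apply/forallP => i; apply: (AP (widen_ord (leqnSn d) i)).
    exact: (AP ord_max).
  case: (ltngtP i d) => [id|di|-> //]; first exact: (AP (Ordinal id)).
  by move: (ltn_ord i); rewrite ltnS leqNgt di.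
by case: P => //=; case: (a) (A 0 x) (A d.+1 x) => -[] [].
Qed.

Lemma absorbs_even n (f : pt n -> bool) (S : {set 'I_n.+1}) d :
  inc G f -> coef f S -> 0 < d <= #|S| -> absorbs R K (mon d true false).
Proof.
move=> Gf fS dS; have /andP[d0 dS'] := dS.
have := absorbs_extract Gf (leq_trans d0 dS'); rewrite fS.
case: (coef (der f) S); last exact: absorbs_shrink.
by move/absorbs_raise; apply: absorbs_shrink; rewrite d0 leqW.
Qed.

Lemma absorbs_odd n (f : pt n -> bool) (S : {set 'I_n.+1}) d :
  inc G f -> coef (der f) S -> 0 < d <= #|S| -> absorbs R K (mon d false true).
Proof.
move=> Gf fS dS; have /andP[d0 dS'] := dS.
have VS := absorbs_extract Gf (leq_trans d0 dS'); rewrite fS in VS.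
(* Raising and then shrinking gives the term with coefficients (1, 0) at size d; it serves to cancel
   c_S when c_S = 1. *)
have V1 : absorbs R K (mon d true false).
  by apply: absorbs_shrink (absorbs_raise VS); rewrite d0 leqW.
have {VS} := absorbs_shrink dS VS; case: (coef f S) => // V2.
move=> m A k RA Kk; apply: inc_ext (absorbsD V1 V2 RA Kk) => x.
by rewrite /mon; case: [forall _, _] => //=; case: (k x) (A 0 x) => -[].
Qed.

End Absorbs.

(** * The classes and their clones in uniform parameters *)

Inductive endtype :=
  EAll | EL of bool | ER of bool | EEq | ENeq | ELR of bool & bool.

(** The cases are the nonempty affine subspaces of GF(2)^2 for the pair (f(0), f(1)): the plane, six
    lines and four points. *)
Definition cE e : set boolfun :=
  match e with
  | EAll => setT
  | EL a => Omega_l a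
  | ER a => Omega_r a
  | EEq => Omega_eq
  | ENeq => Omega_neq
  | ELR a b => Omega_lr a b
  end.

Definition endok e (a b : bool) : bool :=
  match e with
  | EAll => true
  | EL c => a == c
  | ER c => b == c
  | EEq => a == b
  | ENeq => a != b
  | ELR c d => (a == c) && (b == d)
  end.

(** A unary function whose two values satisfy [endok e]: the simplest member of a class, to which
    terms are then added. *)
Definition unary e (x : bool) : bool :=
  match e with
  | EAll | EEq => false
  | EL a | ER a => a
  | ENeq => x
  | ELR a b => if x then b else a
  end.

Definition lep (d : nat) (p : option nat) : bool := if p is Some p' then d <= p' else true.
Definition degp (p : option nat) n (h : pt n -> bool) : Prop :=
  if p is Some d then degle d h else True.
Definition cDo (p : option nat) : set boolfun := if p is Some d then cD d else setT.
Definition cXo (q : option nat) : set boolfun := if q is Some d then cX d.+1 else setT.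

(* The nonconstant stable classes: [p] bounds the degree of f and [q] that of
   f(x) + f(~x), so that [cXo (Some q)] is X_(q+1); [None] means no bound. *)
Definition cK p q e : set boolfun := cDo p `&` cXo q `&` cE e.
(** A degree bound p already gives the rank bound p - 1, so the pair is normalised by q < p. This
    excludes p = 0: the classes of constants are treated separately. *)
Definition valid (p q : option nat) : bool :=
  match p, q with
  | None, _ => true
  | Some p, Some q => q < p
  | Some _, None => false
  end.

(** The part of the right clone due to the bounds; [corr1] is the part due to the values at 0 and 1.
    For p = q + 1 the rank bound is a consequence of the degree bound, so linearity suffices. For q
    = 0 and unbounded degree, members have constant derivatives and self-dual inner functions of any
    degree preserve this. *)
Definition base1 (p q : option nat) : set boolfun :=
  match p, q with
  | _, None => setT
  | None, Some 0 => cS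
  | None, Some _ => cLS
  | Some p, Some q => if p == q.+1 then cL else cLS
  end.
Definition corr1 (q : option nat) e : set boolfun :=
  match e with
  | EAll => setT
  | EL _ => cT false
  | ER _ => cT true
  | ELR _ _ => cTc
  | EEq | ENeq => if q is Some 0 then cS else cTc
  end.
Definition clone1 p q e : set boolfun := base1 p q `&` corr1 q e.

(** For q = 0 and unbounded degree, an end condition that determines the constant f(x) + f(~x) makes
    the inner functions all even or all self-dual, and nonlinear outer functions are then allowed.
    For [ENeq] the required self-duality is in [corr2]. *)
Definition base2 (p q : option nat) e : set boolfun :=
  match p, q with
  | _, None => setT
  | None, Some 0 =>
    match e with
    | EEq | ENeq => setT
    | ELR a b => if a == b then setT else cS
    | _ => cL
    end
  | _, _ => cL
  end.
Definition corr2 e : set boolfun :=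
  match e with
  | EAll | EEq => setT
  | EL a | ER a => cT a
  | ENeq => cS
  | ELR a b => cT a `&` cT b
  end.
Definition clone2 p q e : set boolfun := base2 p q e `&` corr2 e.

Lemma inc_cE e n (h : pt n -> bool) :
  inc (cE e) h <-> endok e (h (cst false)) (h (cst true)).
Proof.
rewrite /inc; case: e => [|a|a|||a b] /=; rewrite ?ffunE //.
- by rewrite /Omega_l /value_at /= ffunE; split=> [->|/eqP].
- by rewrite /Omega_r /value_at /= ffunE; split=> [->|/eqP].
- by rewrite /Omega_eq /value_at /= !ffunE; split=> [->|/eqP].
- by rewrite /Omega_neq /value_at /= !ffunE; split=> /eqP.
rewrite /Omega_lr /Omega_l /Omega_r /value_at /=; split=> [[]|].
  by rewrite /= !ffunE => -> ->; rewrite !eqxx.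
by move=> /andP[/eqP ha /eqP hb]; split; rewrite /= ffunE.
Qed.

Lemma inc_cK p q e n (h : pt n -> bool) : inc (cK p q e) h <->
  [/\ degp p h, degp q (der h) & endok e (h (cst false)) (h (cst true))].
Proof.
rewrite !inc_setI inc_cE.
have -> : inc (cDo p) h <-> degp p h by case: p => [p|//]; apply: inc_cD.
have -> : inc (cXo q) h <-> degp q (der h) by case: q => [q|//]; apply: inc_cX_degle.
by split=> [[[]]|[]].
Qed.

Lemma degle_max n (h : pt n -> bool) : degle n.+1 h.
Proof.
move=> S; rewrite ltnNge -[X in _ <= X]card_ord.
by rewrite max_card.
Qed.

Lemma degp_const p n c : degp p (fun _ : pt n => c).
Proof. by case: p => //= d; apply: degle_const. Qed.
Arguments degp_const p [n] c.

Lemma degp_lep p d n (h : pt n -> bool) : lep d p -> degle d h -> degp p h.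
Proof. by case: p => //= p; apply: degle_le. Qed.

Lemma degp_ext p n (h h' : pt n -> bool) : h =1 h' -> degp p h -> degp p h'.
Proof. by case: p => //= p; apply: degle_ext. Qed.

Lemma degpD p n (h h' : pt n -> bool) :
  degp p h -> degp p h' -> degp p (fun x => h x (+) h' x).
Proof. by case: p => //= p; apply: degleD. Qed.

Lemma eq_mon d a b v v' : (forall j, j <= d -> v j = v' j) ->
  mon d a b v = mon d a b v'.
Proof.
move=> vv; rewrite /mon vv //; congr (_ && _).
by apply: eq_forallb => i; rewrite vv.
Qed.

Lemma mon_cst d a b c : 0 < d -> mon d a b (fun=> c) = false.
Proof.
move=> d0; apply/negbTE; rewrite negb_and negb_forall.
by apply/orP; left; apply/existsP; exists (Ordinal d0); rewrite addbb.
Qed.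

Lemma degle_mon d a (b : bool) n (A : nat -> pt n -> bool) :
  (forall j, degle 1 (A j)) -> degle (d + b) (fun x => mon d a b (fun j => A j x)).
Proof.
move=> A1; apply: degleM.
  have := @degle_all 1 n _ (enum 'I_d) (fun i x => A i.+1 x (+) A 0 x)
    (fun i _ => degleD (A1 _) (A1 _)).
  rewrite -cardE card_ord muln1; apply: degle_ext => x.
  apply/allP/forallP => [Ax i|Ax i _]; first by apply: Ax; rewrite mem_enum.
  exact: Ax.
by apply: degleD; [apply: degle_const|case: b; [apply: A1|apply: degle_const]].
Qed.

Lemma der_mon d a b n (A : nat -> pt n -> bool) :
  (forall j, inc cS (A j)) ->
  der (fun x => mon d a b (fun j => A j x)) =1
  fun x => mon d b false (fun j => A j x).
Proof.
move=> AS x; rewrite /der /mon.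
rewrite (_ : [forall i : 'I_d, A i.+1 (compl x) (+) A 0 (compl x)] =
  [forall i : 'I_d, A i.+1 x (+) A 0 x]); last first.
  by apply: eq_forallb => i; rewrite !(inc_cS _).1 // addbN addNb negbK.
rewrite (inc_cS _).1 //; case: [forall _, _] => //=.
by case: (a) (b) (A 0 x) => -[] [].
Qed.

Lemma unaryE e x :
  unary e x = unary e false (+) ((unary e false (+) unary e true) && x).
Proof. by case: e => [|[]|[]|||[] []]; case: x. Qed.

Lemma endok_unary e : endok e (unary e false) (unary e true).
Proof. by case: e => [|[]|[]|||[] []]. Qed.

Lemma der_unary e n i x :
  der (fun x : pt n => unary e (x i)) x = unary e false (+) unary e true.
Proof.
rewrite /der unaryE [X in _ (+) X]unaryE ffunE.
by case: (x i); case: (unary e false) (unary e true) => -[].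
Qed.

Lemma degle_unary e n i : degle 1 (fun x : pt n => unary e (x i)).
Proof.
apply: (degle_ext (fun x => esym (unaryE e (x i)))); apply: degleD.
  exact: degle_const.
by case: (_ (+) _) => /=; [apply: degle_proj|apply: degle_const].
Qed.

Lemma inc_unary p q e n i : lep 1 p -> inc (cK p q e) (fun x : pt n => unary e (x i)).
Proof.
move=> p1; apply/inc_cK; split.
- exact: degp_lep p1 (degle_unary e i).
- by apply: (degp_ext _ (degp_const q _)) => x; rewrite der_unary.
by rewrite !ffunE endok_unary.
Qed.

Lemma inc_add_mon p q e n (k : pt n -> bool) (A : nat -> pt n -> bool) d a (b : bool) :
  inc (cK p q e) k -> (forall j, inc cLc (A j)) -> 0 < d ->
  lep (d + b) p -> b ==> lep d q ->
  inc (cK p q e) (fun x => k x (+) mon d a b (fun j => A j x)).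
Proof.
move=> /inc_cK[kp kq ke] LA d0 dp dq; apply/inc_cK; split.
- apply: degpD => //; apply: (degp_lep dp); apply: degle_mon => j.
  by have [/inc_cD] := LA j.
- have dE := derD k (fun x => mon d a b (fun j => A j x)).
  apply: (degp_ext (fsym dE)); apply: degpD => //.
  apply: (degp_ext (fsym (der_mon _ _ _ _))); first by move=> j; apply/cLc_sub_cS.
  case: b {dp dE} dq => /= [dq|_]; last first.
    by apply: (degp_ext _ (degp_const q false)) => x; rewrite /mon andbF.
  rewrite -[d]addn0 in dq; apply: (degp_lep dq); apply: (@degle_mon d true false n A) => j.
  by have [/inc_cD] := LA j.
have Acst c j : A j (cst c) = c by have [_ /inc_cTc[]] := LA j; case: c.
have mcst c : mon d a b (fun j => A j (cst c)) = false.
  by rewrite (eq_mon _ _ (fun j _ => Acst c j)) mon_cst.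
by rewrite !mcst !addbF.
Qed.

Definition witness e d a b N (x : pt N) : bool :=
  unary e (x ord0) (+) mon d a b (fun j => x (inord j)).

Lemma inc_witness p q e d a (b : bool) N : 0 < d -> lep (d + b) p -> b ==> lep d q ->
  inc (cK p q e) (@witness e d a b N).
Proof.
move=> d0 dp dq; apply: inc_add_mon => //; last by move=> j; apply: inc_cLc_proj.
apply: inc_unary; case: (p) dp => //= p'; apply: leq_trans.
by rewrite (leq_trans d0) ?leq_addr.
Qed.

Lemma mon_ind N d a b (T : {set 'I_N.+1}) (S := [set i : 'I_N.+1 | 0 < i <= d]%SET) :
  d <= N -> T \subset S -> mon d a b (fun j => ind T (inord j)) = (T == S) && a.
Proof.
move=> dN /fintype.subsetP TS; rewrite /mon.
have -> : ind T (inord 0) = false.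
  by rewrite ffunE; apply/negbTE/negP => /TS; rewrite finset.inE inordK.
rewrite andbF addbF; congr (_ && _); rewrite finset.eqEsubset.
rewrite (introT (fintype.subsetP) TS) /=; apply/forallP/fintype.subsetP => iT i.
  rewrite finset.inE => /andP[i0 id]; have lt : i.-1 < d by rewrite prednK.
  by have := iT (Ordinal lt); rewrite addbF ffunE /= prednK // inord_val.
rewrite addbF ffunE; apply: iT; rewrite finset.inE inordK ?ltn_ord //.
by rewrite ltnS (leq_trans _ dN).
Qed.

Lemma mon_ind_compl N d a b (T : {set 'I_N.+1}) (S := [set i : 'I_N.+1 | 0 < i <= d]%SET) :
  d <= N -> T \subset S ->
  mon d a b (fun j => compl (ind T) (inord j)) = (T == S) && (a (+) b).
Proof.
move=> dN TS.
have := @der_mon d a b N (fun j x => x (inord j))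
  (fun j => cLc_sub_cS (inc_cLc_proj _)) (ind T).
rewrite /der (mon_ind _ _ dN TS) (mon_ind _ _ dN TS) => E.
by rewrite -[LHS](addKb ((T == S) && a)) E; case: (T == S).
Qed.

Lemma card_segment N d : d <= N -> #|[set i : 'I_N.+1 | 0 < i <= d]%SET| = d.
Proof.
move=> dN; rewrite cardsE -sum1_card.
rewrite -(big_mkord (fun i => 0 < i <= d) (fun=> 1)) /=.
rewrite (big_cat_nat _ (n := d.+1)) //= addnC big1_seq ?add0n; last first.
  move=> i; rewrite mem_index_iota => /andP[/andP[_ id] /andP[di _]].
  by move: di; rewrite ltnNge id.
rewrite big_ltn_cond //= big_mkcond (eq_big_nat _ _ (F2 := fun=> 1)) => [|i].
  by rewrite sum_nat_const_nat subn1 muln1.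
by rewrite ltnS => ->.
Qed.

(** The coefficients at {1, ..., d} of the witness and of its derivative are a and b: the unary part
    depends on x_0 only and has a constant derivative. If only b is 1, the bound on p comes from q <
    p. *)
Lemma witness_bound p q e d a b N : valid p q -> 0 < d <= N ->
  inc (cK p q e) (@witness e d a b N) ->
  (a || b -> lep d p) /\ (b -> lep d q).
Proof.
move=> pq /andP[d0 dN] /inc_cK[Wp Wq _].
pose S := [set i : 'I_N.+1 | 0 < i <= d]%SET.
have S0 : #|S| = d by rewrite card_segment.
have aE : coef (@witness e d a b N) S = a.
  rewrite /witness coef_addb.
  rewrite [X in X (+) _](_ : _ = false); last first.
    have dS : Ordinal (leq_ltn_trans d0 (leq_ltn_trans dN (ltnSn N))) \in S.
      by rewrite finset.inE /= d0.
    apply: (powerset_cancel dS) => T _ _; rewrite !ffunE finset.in_setU1.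
    by rewrite (_ : (_ == _) = false).
  rewrite /coef powerset_top => [|T TS /negbTE TnS]; last first.
    by rewrite mon_ind // TnS.
  by rewrite mon_ind // eqxx.
have bE : coef (der (@witness e d a b N)) S = b.
  rewrite (eq_coef (derD _ _)) coef_addb.
  rewrite (eq_coef (der_unary e (ord0 : 'I_N.+1))) (degle_const (d := 0)) ?S0 //=.
  rewrite /coef powerset_top => [|T TS /negbTE TnS]; last first.
    by rewrite /der mon_ind // mon_ind_compl // TnS.
  by rewrite /der mon_ind // mon_ind_compl // eqxx /= addbA addbb.
have bq : b -> lep d q.
  case: q {pq} Wq => //= q' Wq /negPn; apply: contraR; rewrite -ltnNge => qd.
  by rewrite -bE Wq // S0.
split=> // /orP[a1|/bq].
  case: p {pq} Wp => //= p' Wp; rewrite leqNgt; apply: contraL a1 => pd.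
  by rewrite -aE Wp // S0.
case: p q {Wp Wq bq} pq => [p'|] [q'|] //= qp dq.
exact: leq_trans dq (ltnW qp).
Qed.

(** * The expected clones, and the inclusions that they satisfy *)

Lemma cT_clone a : clone (cT a).
Proof.
split=> [n i|]; first by rewrite /cT /value_at /= !ffunE.
apply: sub_comp => n m f A /inc_cT fa Aa; apply/inc_cT.
by rewrite (@cst_comp _ _ _ a a) // => i; apply/inc_cT.
Qed.

Lemma cS_clone : clone cS.
Proof.
split=> [n i x|]; first by rewrite /= !ffunE.
apply: sub_comp => n m f A /inc_cS fS AS; apply/inc_cS => x.
by rewrite compl_comp // fS.
Qed.

Lemma cL_clone : clone cL.
Proof.
split=> [n i|]; first exact/inc_cD/degle_proj.
apply: sub_comp => n m f A /inc_cD fL AL; apply/inc_cD.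
by apply: (degle_comp (e := 1) fL) => i; apply/inc_cD.
Qed.

Lemma setT_clone : clone setT.
Proof. by []. Qed.

Lemma setI_clone C1 C2 : clone C1 -> clone C2 -> clone (C1 `&` C2).
Proof.
move=> [p1 c1] [p2 c2]; split=> [n i|]; first by split.
apply: sub_comp => n m f A [f1 f2] A12.
by split; [apply: inc_comp c1 f1 _|apply: inc_comp c2 f2 _] => i; have [] := A12 i.
Qed.

Lemma clone_proj C n i : clone C -> inc C (fun x : pt n => x i).
Proof. by move=> [+ _]; apply. Qed.

Lemma clone_comp C n m (f : pt n -> bool) (A : 'I_n.+1 -> pt m -> bool) :
  clone C -> inc C f -> (forall i, inc C (A i)) -> inc C (fun x => f [ffun i => A i x]).
Proof. by move=> [_]; apply: inc_comp. Qed.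

Lemma clone1_clone p q e : clone (clone1 p q e).
Proof.
have [? ? ?] := And3 cS_clone cL_clone setT_clone.
have ? := cT_clone; apply: setI_clone.
  case: p q => [p|] [[|q]|] //=; try case: ifP => _ //; exact: setI_clone.
case: e => [|a|a|||a b] //=; try (case: q => [[|q]|] //); exact: setI_clone.
Qed.

Lemma clone2_clone p q e : clone (clone2 p q e).
Proof.
have [? ? ?] := And3 cS_clone cL_clone setT_clone.
have ? := cT_clone; apply: setI_clone.
  case: p q => [p|] [[|q]|] //=; case: e => //= a b; by case: ifP.
by case: e => //= *; apply: setI_clone.
Qed.

Lemma cLc_clone1 p q e : cLc `<=` clone1 p q e.
Proof.
move=> f /(incP cLc) Lf; have Sf := cLc_sub_cS Lf; apply/(incP (clone1 p q e)).
have [fL [f0 f1]] := Lf; split.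
  case: p q => [p|] [[|q]|] //=; by case: ifP.
by case: e => [|[]|[]|||a b] //=; case: q => [[|q]|].
Qed.

Lemma cLc_clone2 p q e : cLc `<=` clone2 p q e.
Proof.
move=> f /(incP cLc) Lf; have Sf := cLc_sub_cS Lf; apply/(incP (clone2 p q e)).
have [fL [f0 f1]] := Lf; split.
  case: p q => [p|] [[|q]|] //=; case: e => //= a b; by case: ifP.
by case: e => [|[]|[]|||[] []] //=; split.
Qed.

Lemma base1_cL p q f : valid (Some p) q -> base1 (Some p) q f -> cL f.
Proof. by case: q => //= q _; case: ifP => // _ []. Qed.

Lemma base1_cS p q f : p != Some q.+1 -> base1 p (Some q) f -> cS f.
Proof.
case: p q => [p|] [|q] //= pq; last by case.
  by case: ifP => [/eqP pE|_ []//]; rewrite pE eqxx in pq.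
by case: ifP => [/eqP pE|_ []//]; rewrite pE eqxx in pq.
Qed.

Lemma cK_clone1 p q e : valid p q -> cK p q e `o` clone1 p q e `<=` cK p q e.
Proof.
move=> pq; apply: sub_comp => n m f A /inc_cK[fp fq fe] BA.
have B1 i : inc (base1 p q) (A i) by have [] := BA i.
have Ap : degp p (fun x => f [ffun i => A i x]).
  case: p pq fp B1 {BA} => //= p pq fp B1; rewrite -[p]muln1.
  by apply: degle_comp fp _ => i; apply/inc_cD/(base1_cL pq)/B1.
apply/inc_cK; split=> //.
  case: q pq fq {fe BA} B1 => //= q pq fq B1.
  case: (eqVneq p (Some q.+1)) => [pE|pE]; first by rewrite pE in Ap; apply: degle_der.
  have AS i : inc cS (A i) by apply: base1_cS pE (B1 i).
  apply: (degle_ext (fsym (der_comp f AS))).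
  case: q pq fq B1 pE => [|q] pq fq B1 pE.
    (* The degree bound is 0 times the inner degree, so the inner functions may have any degree. *)
    exact: (degle_comp fq (fun i => @degle_max _ (A i))).
  rewrite -[q.+1]muln1; apply: degle_comp fq _ => i; apply/inc_cD.
  move: (B1 i) pq; case: p {Ap fp B1 pE} => [p|] /=; last by case.
  by case: ifP => // _ [].
have A2 i : inc (corr1 q e) (A i) by have [] := BA i.
have ends b : (forall i, inc (cT b) (A i)) -> [ffun i => A i (cst b)] = cst b.
  by move=> Ab; apply: cst_comp => i; apply/inc_cT.
case: e {BA} fe A2 => [|a|a|||a b] //= fe A2.
- by rewrite ends.
- by rewrite ends.
- case: q {pq B1 Ap} fq A2 => [[|q]|] fq A2.
  (* Self-dual inner functions send the constant points to some y and its complement. The derivative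
     of [f] is constant, so f(y) and f(~y) compare as f(0) and f(1) do. *)
  + have := compl_comp (cst false) A2; rewrite compl_cst => ->.
    move: (degle0 fq [ffun i => A i (cst false)] (cst false)).
    by rewrite /der compl_cst (eqP fe) addbb => /(canRL (addKb _)) ->; rewrite addbF.
  + by rewrite !ends // => i; have [] := A2 i.
  by rewrite !ends // => i; have [] := A2 i.
- case: q {pq B1 Ap} fq A2 => [[|q]|] fq A2.
  + have := compl_comp (cst false) A2; rewrite compl_cst => ->.
    move: (degle0 fq [ffun i => A i (cst false)] (cst false)).
    rewrite /der compl_cst => /(canRL (addKb _)) ->.
    by move: fe; case: (f _) (f (cst true)) (f (cst false)) => [] [] [].
  + by rewrite !ends // => i; have [] := A2 i.
  by rewrite !ends // => i; have [] := A2 i.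
by rewrite !ends // => i; have [] := A2 i.
Qed.

(** With an affine outer function, the derivative of the composite is a sum of derivatives of inner
    functions. *)
Lemma der_affine q n m (f : pt n -> bool) (A : 'I_n.+1 -> pt m -> bool) :
  degle 1 f -> (forall i, degle q (der (A i))) ->
  degle q (der (fun x => f [ffun i => A i x])).
Proof.
move=> fL Aq.
pose t (S : {set 'I_n.+1}) (x : pt m) := coef f S &&
  ([forall i in S, A i x] (+) [forall i in S, A i (compl x)]).
have tE x : \big[addb/false]_S t S x = der (fun x => f [ffun i => A i x]) x.
  rewrite /der [X in X (+) _]moebius [X in _ (+) X]moebius -big_split /=.
  apply: eq_bigr => S _; rewrite /t andb_addr.
  by congr ((_ && _) (+) (_ && _)); apply: eq_forallb => i; rewrite ffunE.
apply: (degle_ext tE); apply: degle_sum => S _; rewrite /t.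
case: (boolP (coef f S)) => fS; last exact: degle_const.
have S1 : #|S| <= 1 by rewrite leqNgt; apply: contraL fS => /fL ->.
case: (posnP #|S|) => [/eqP|S0].
  rewrite finset.cards_eq0 => /eqP ->.
  have E0 x : [forall i in finset.set0, A i x].
    by apply/forallP => i; rewrite finset.in_set0.
  by apply: (degle_ext _ (degle_const false)) => x; rewrite !E0.
have /finset.cards1P[i ->] : #|S| == 1 by rewrite eqn_leq S1.
have E x : [forall j in [set i]%SET, A j x] = A i x.
  apply/'forall_implyP/idP => [->//|Ai j]; first by rewrite finset.in_set1.
  by rewrite finset.in_set1 => /eqP ->.
by apply: degle_ext (Aq i) => x; rewrite !E.
Qed.

Lemma valid_lep1 p q : valid p q -> lep 1 p.
Proof. by case: p q => [p|] [q|] //=; apply: leq_ltn_trans. Qed.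

Lemma clone2_cK p q e : valid p q -> clone2 p q e `o` cK p q e `<=` cK p q e.
Proof.
move=> pq; have p1 := valid_lep1 pq; apply: sub_comp => n m f A [f1 f2] KA.
have Ap i : degp p (A i) by have /inc_cK[] := KA i.
have Aq i : degp q (der (A i)) by have /inc_cK[] := KA i.
have Ae i : endok e (A i (cst false)) (A i (cst true)) by have /inc_cK[] := KA i.
have val_cst b c : (forall i, A i (cst b) = c) -> [ffun i => A i (cst b)] = cst c.
  exact: cst_comp.
have eE : endok e (f [ffun i => A i (cst false)]) (f [ffun i => A i (cst true)]).
  case: e {KA f1} f2 Ae => [|a|a|||a b] //=.
  - by move/inc_cT => fa Ae; rewrite (val_cst _ a) ?fa // => i; apply/eqP.
  - by move/inc_cT => fa Ae; rewrite (val_cst _ a) ?fa // => i; apply/eqP.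
  - by move=> _ Ae; rewrite (_ : finfun _ = [ffun i => A i (cst true)]) //;
      apply/ffunP => i; rewrite !ffunE; apply/eqP.
  - move/inc_cS => fS Ae;
    rewrite (_ : [ffun i => A i (cst true)] = compl [ffun i => A i (cst false)]).
      by rewrite fS; case: (f _).
    by apply/ffunP => i; rewrite !ffunE; have := Ae i; case: (A i _) (A i _) => [] [].
  move=> [/inc_cT fa /inc_cT fb] Ae.
  by rewrite (val_cst _ a) ?(val_cst _ b) ?fa ?fb ?eqxx // => i;
    have /andP[/eqP ? /eqP ?] := Ae i.
have linear : inc cL f -> inc (cK p q e) (fun x => f [ffun i => A i x]).
  move=> /inc_cD fL; apply/inc_cK; split=> //.
    by case: p Ap {pq p1 f1 KA} => //= p Ap; rewrite -[p]mul1n; apply: degle_comp.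
  by case: q Aq {pq f1 KA} => //= q Aq; apply: der_affine.
case: p q pq p1 f1 Ap Aq linear {KA} => [p|] [q|] //= pq p1 f1 Ap Aq linear.
- exact: linear.
- case: q {pq} f1 Aq linear => [|q] //= f1 Aq linear; last exact: linear.
  (* Each inner function has a constant derivative, read off at the constant points. If it is 0,
     complementing x does not change the arguments of [f] at all; if it is 1 ([odd]), the inner
     functions are self-dual and a self-dual [f] yields a self-dual composite. *)
  have even : (forall i, A i (cst false) = A i (cst true)) -> forall x y,
      der (fun x => f [ffun i => A i x]) x = der (fun x => f [ffun i => A i x]) y.
    move=> A01; suff E x : der (fun x => f [ffun i => A i x]) x = false by move=> *; rewrite !E.
    rewrite /der (_ : [ffun i => A i (compl x)] = [ffun i => A i x]) ?addbb //.
    apply/ffunP => i; rewrite !ffunE; have := degle0 (Aq i) x (cst false).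
    by rewrite /der compl_cst A01 addbb; case: (A i x) (A i (compl x)) => [] [].
  have odd : (forall i, A i (cst false) != A i (cst true)) -> inc cS f -> forall x y,
      der (fun x => f [ffun i => A i x]) x = der (fun x => f [ffun i => A i x]) y.
    move=> A01 fS; suff AS i : inc cS (A i).
      by move=> x y; rewrite !der_comp // !(inc_cS_der _).1.
    apply/inc_cS_der => x; rewrite (degle0 (Aq i) x (cst false)) /der compl_cst.
    by have := A01 i; case: (A i _) (A i _) => [] [].
  have fin : (forall x y, der (fun x => f [ffun i => A i x]) x =
                          der (fun x => f [ffun i => A i x]) y) ->
      inc (cK None (Some 0) e) (fun x => f [ffun i => A i x]).
    move=> dc; apply/inc_cK; split=> //=.
    by apply: (degle_ext _ (degle_const (der (fun x => f [ffun i => A i x]) (cst false)))).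
  case: e f1 f2 Ae {eE} linear fin => [|a|a|||a b] /= f1 f2 Ae linear fin; try exact: linear.
  + by apply/fin/even => i; apply/eqP.
  + exact/fin/odd.
  case: ifP f1 => [/eqP ab _|ab f1]; apply: fin.
    by apply: even => i; have /andP[/eqP-> /eqP->] := Ae i.
  by apply: odd => // i; have /andP[/eqP-> /eqP->] := Ae i; rewrite ab.
by apply/inc_cK; split.
Qed.

Lemma subst_witness p q e C d a (b : bool) m (A : nat -> pt m -> bool) :
  cK p q e `o` C `<=` cK p q e -> (forall j, inc C (A j)) ->
  0 < d -> lep (d + b) p -> b ==> lep d q ->
  inc (cK p q e) (fun x => unary e (A 0 x) (+) mon d a b (fun j => A j x)).
Proof.
move=> KC CA d0 dp dq.
apply: inc_ext (inc_comp KC (@inc_witness p q e d a b d d0 dp dq)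
  (fun i => CA (nat_of_ord i))) => x.
rewrite /witness ffunE /=; congr (_ (+) _); apply: eq_mon => j jd.
by rewrite ffunE inordK.
Qed.

Lemma cK_xor3 p q e : valid p q -> xor3_closed (cK p q e).
Proof.
move=> pq; apply: xor3_stable => h [f [m [g [Lf Kg hE]]]].
apply: (clone2_cK pq); exists f, m, g; split=> //.
exact: cLc_clone2.
Qed.

(** * Maximality of the right clone *)

Section RightCompleteness.
Variables (p q : option nat) (e : endtype) (C : set boolfun).
Hypothesis pq : valid p q.
Let p1 : lep 1 p := valid_lep1 pq.
Hypotheses (Cclone : clone C) (KC : cK p q e `o` C `<=` cK p q e).

(* Substituting g for one factor of a witness of size r + 1, at all the minors
   that [sum_minors] adds up, produces a witness of size #|S| + r. *)
Lemma grow_witness n (g : pt n -> bool) (S : {set 'I_n.+1}) r c0 (c1 : bool) :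
  inc C g -> 0 < #|S| -> coef g S ->
  lep (r.+1 + c1) p -> c1 ==> lep r.+1 q ->
  inc (cK p q e) (@witness e (#|S| + r) c0
    (c1 (+) (coef (der g) S && (c0 (+) c1))) (#|S| + r)).
Proof.
move=> Cg S0 gS rp rq; set s := #|S| in S0 *; set N := s + r.
have x_C j : inc C (fun x : pt N => x (inord j)) by apply: clone_proj.
pose M (x : pt N) := mon r c0 c1 (fun j => x (inord (if j is 0 then 0 else s + j))).
pose X (t : pt N -> bool) := forall k : pt N -> bool,
  inc (cK p q e) k -> inc (cK p q e) (fun x => k x (+) (t x && M x)).
pose B (j : nat) (x : pt N) := x (inord j).
pose G T := g \o minor_at S B T.
have CG T : inc C (G T) by apply: clone_comp => // i; apply: x_C.
pose A T j : pt N -> bool := match j with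
  | 0 => B 0 | 1 => G T | j.+1 => B (s + j) end.
have KA T : inc (cK p q e) (fun x => unary e (x (inord 0)) (+)
    ((G T x (+) x (inord 0)) && M x)).
  have CA j : inc C (A T j) by case: j => [|[|j]]; [apply: x_C|apply: CG|apply: x_C].
  apply: inc_ext (subst_witness c0 KC CA (ltn0Sn r) rp rq) => x.
  congr (_ (+) _); rewrite /M /mon andbA; congr (_ && _).
  apply/forallP/andP => [Ax|[A0 /forallP Ax] i].
    split; first exact: (Ax ord0).
    by apply/forallP => i; apply: (Ax (lift ord0 i)).
  case: (unliftP ord0 i) => [i' ->|->]; last exact: A0.
  exact: (Ax i').
have XS : X (fun x => mon s (coef g S) (coef (der g) S) (fun j => B j x)).
  apply: extract => //.
  - by move=> k; apply: inc_ext => x; rewrite addbF.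
  - move=> h h' Xh Xh' k Kk; apply: inc_ext (Xh' _ (Xh _ Kk)) => x.
    by rewrite andb_addl addbA.
  move=> T T' k Kk.
  (* The unary part and the summand x_0 of the replaced factor occur twice and cancel, which leaves
     k + (g_T + g_T') M. *)
  apply: inc_ext (cK_xor3 pq Kk (KA T) (KA T')) => x.
  congr (_ (+) _); rewrite -[minor_at _ _ _ _]/(minor_at S B T x).
  rewrite /G /=; case: (M x); rewrite ?andbF ?addbF ?addbb // !andbT.
  by rewrite addbACA addbb addFb addbACA addbb addbF.
have u_K : inc (cK p q e) (fun x : pt N => unary e (x ord0)) by apply: inc_unary.
apply: inc_ext (XS _ u_K) => x; rewrite /witness; congr (_ (+) _).
rewrite gS /M /mon /B.
have -> : [forall i : 'I_(s + r), x (inord i.+1) (+) x (inord 0)] =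
  [forall i : 'I_s, x (inord i.+1) (+) x (inord 0)] &&
  [forall i : 'I_r, x (inord (s + i.+1)) (+) x (inord 0)].
  apply/forallP/andP => [Ax|[/forallP Ax /forallP Ax'] i].
    split; apply/forallP => i; first exact: (Ax (lshift r i)).
    by rewrite addnS; apply: (Ax (rshift s i)).
  by case: (split_ordP i) => j ->; [apply: Ax|rewrite /= -addnS; apply: Ax'].
case: [forall _, _] => //=; case: [forall _, _]; rewrite ?andbF //=.
by move: (c0) (c1) (coef (der g) S) (x (inord 0)) => [] [] [] [].
Qed.

Lemma right_linear_deg d : p = Some d -> C `<=` cL.
Proof.
move=> pE f /(incP C) Cf; apply/(incP cL)/inc_cD => S S1.
apply/negP => fS; have S0 : 0 < #|S| by apply: ltnW.
case: d pE => [|d] pE; first by move: (p1); rewrite pE.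
have pd : lep (d.+1 + false) p by rewrite pE /= addn0.
have := grow_witness true Cf S0 fS pd isT.
case/(witness_bound pq) => [|+ _]; first by rewrite leqnn addn_gt0 S0.
rewrite pE /= => /(_ isT); rewrite leqNgt => /negP; apply.
exact: (leq_add S1 (leqnn d)).
Qed.

Lemma right_linear_rank d : p = None -> q = Some d.+1 -> C `<=` cL.
Proof.
move=> pE qE f /(incP C) Cf; apply/(incP cL)/inc_cD => S S1.
apply/negP => fS; have S0 : 0 < #|S| by apply: ltnW.
(* The grown term has odd coefficient c1 + d_S (c0 + c1), which has to be 1: (c0, c1) = (1, 0) works
   if d_S = 1, and (0, 1) if d_S = 0. *)
case: (boolP (coef (der f) S)) => bS.
  have pd : lep (d.+2 + false) p by rewrite pE.
  have := grow_witness true Cf S0 fS pd isT.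
  case/(witness_bound pq) => [|_]; first by rewrite leqnn addn_gt0 S0.
  rewrite bS qE /= => /(_ isT); rewrite leqNgt => /negP; apply.
  exact: (leq_add S0 (leqnn d.+1)).
have pd : lep (d.+1 + true) p by rewrite pE.
have qd : true ==> lep d.+1 q by rewrite qE /=.
have := grow_witness false Cf S0 fS pd qd.
case/(witness_bound pq) => [|_]; first by rewrite leqnn addn_gt0 S0.
rewrite (negbTE bS) qE /= => /(_ isT); rewrite leqNgt => /negP; apply.
exact: (leq_add S1 (leqnn d)).
Qed.

(** If f(y) = f(~y), the minor of [f] with x_1 at the ones of y and x_0 elsewhere equals f(y)
    whenever x_1 = ~x_0. Put for the last variable of the even term of size d + 2, it turns the last
    factor into f(y) + x_0, so a term with d_S = 1 and |S| = d + 1 appears. *)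
Lemma right_selfdual d : q = Some d -> lep d.+2 p -> C `<=` cS.
Proof.
move=> qE pd f /(incP C) Cf; apply/(incP cS)/inc_cS => y.
case: (eqVneq (f (compl y)) (f y)) => [fy|]; last first.
  by case: (f (compl y)) (f y) => [] [].
pose A j (x : pt d.+1) : bool := if j == d.+2
  then f [ffun i => (if y i then x (inord 1) else x (inord 0))] else x (inord j).
have CA j : inc C (A j).
  rewrite /A; case: eqP => _; last exact: clone_proj.
  apply: (clone_comp Cclone Cf (A := fun i x => if y i then x (inord 1) else x (inord 0))) => i.
  by case: (y i); apply: clone_proj.
rewrite -[d.+2]addn0 in pd.
have W := @subst_witness p q e C d.+2 true false _ A KC CA (ltn0Sn _) pd isT.
have /(witness_bound pq) : inc (cK p q e) (@witness e d.+1 (f y) true d.+1).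
  apply: inc_ext W => x; rewrite /witness /mon /A /= andbT.
  rewrite (_ : inord 0 = ord0); last by apply: val_inj; rewrite /= inordK.
  congr (_ (+) _).
  have -> : [forall i : 'I_d.+2, (if i.+1 == d.+2
      then f [ffun i => (if y i then x (inord 1) else x ord0)]
      else x (inord i.+1)) (+) x ord0] =
    [forall i : 'I_d.+1, x (inord i.+1) (+) x ord0] &&
    (f [ffun i => (if y i then x (inord 1) else x ord0)] (+) x ord0).
    apply/forallP/andP => [Ax|[/forallP Ax Af] i].
      split; last by have := Ax ord_max; rewrite /= eqxx.
      apply/forallP => i; have := Ax (widen_ord (leqnSn _) i).
      by rewrite /= eqSS ltn_eqF.
    case: eqP => [//|/eqP]; rewrite eqSS => id.
    have lt : i < d.+1 by rewrite ltn_neqAle id -ltnS ltn_ord.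
    exact: (Ax (Ordinal lt)).
  case: (boolP [forall i : 'I_d.+1, _]) => //= /forallP /(_ ord0) /= x10.
  have {}x10 : x (inord 1) = ~~ x ord0 by case: (x (inord 1)) (x ord0) x10 => [] [].
  congr (_ (+) _); rewrite x10; case: (x ord0).
    rewrite -fy; congr (bfun f _); apply/ffunP => i; rewrite !ffunE; by case: (y i).
  by congr (bfun f _); apply/ffunP => i; rewrite !ffunE; case: (y i).
by rewrite qE /= ltnn leqnn => /(_ isT) [_ /(_ isT)].
Qed.

Lemma right_corr : C `<=` corr1 q e.
Proof.
move=> f /(incP C) Cf; apply/(incP (corr1 q e)); set n := predar f in Cf *.
pose A j (x : pt n) : bool := if j is 0 then x ord0 else f x.
have CA j : inc C (A j) by case: j => [|j]; [apply: clone_proj|].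
have p1' : lep (1 + false) p by [].
have W10 := subst_witness true KC CA (ltn0Sn 0) p1' isT.
have mon1 a b x : mon 1 a b (fun j => A j x) = (f x (+) x ord0) && (a (+) (b && x ord0)).
  rewrite /mon; congr (_ && _); apply/forallP/idP => [/(_ ord0)//|fx i].
  by rewrite (ord1 i).
have /inc_cK[_ W10q W10e] := W10.
rewrite /= !mon1 !ffunE in W10e.
(* The terms (f + x_0)(1 + x_0) and (f + x_0) x_0 change the value at a single constant point,
   respectively 0 and 1. A condition comparing the two values thus forces f to fix each point. *)
have strict : q != Some 0 -> e = EEq \/ e = ENeq -> inc cTc f.
  move=> q0 ee.
  have q1 : true ==> lep 1 q by case: (q) q0 => // -[].
  have p2 : lep (1 + true) p.
    case: (p) (q) pq q1 => [p'|] [q'|] //= qp q1.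
    exact: leq_ltn_trans q1 qp.
  have /inc_cK[_ _] := subst_witness false KC CA (ltn0Sn 0) p2 q1.
  have /inc_cK[_ _] := subst_witness true KC CA (ltn0Sn 0) p2 q1.
  rewrite /= !mon1 !ffunE inc_cTc.
  by case: ee => ->; case: (f _) (f (cst true)) => [] [].
(* Adding f + x_0 must keep the derivative constant, so the derivative of f is constant; the end
   condition makes it 1. *)
have dual : q = Some 0 -> e = EEq \/ e = ENeq -> inc cS f.
  move=> q0 ee; apply/inc_cS_der => x.
  have := W10q; rewrite q0 => /degle0 /(_ x (cst false)).
  rewrite /der compl_cst /= !mon1 !ffunE.
  by case: ee W10e => -> /=;
    case: (x _) (f x) (f (compl x)) (f (cst false)) (f (cst true)) => [] [] [] [] [].
case: e (W10e) strict dual => [|a|a|||a b] //= We strict dual.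
- by apply/inc_cT; move: We; case: (a) (f _) => [] [].
- by apply/inc_cT; move: We; case: (a) (f (cst true)) => [] [].
- by case: (q) strict dual => [[|q']|] strict dual;
    [apply: dual|apply: strict|apply: strict]; try left.
- by case: (q) strict dual => [[|q']|] strict dual;
    [apply: dual|apply: strict|apply: strict]; try right.
by apply/inc_cTc; move: We; case: (a) (b) (f _) (f (cst true)) => [] [] [] [].
Qed.

Lemma right_complete : C `<=` clone1 p q e.
Proof.
move=> f Cf; split; last exact: right_corr.
case: p q pq right_linear_deg right_linear_rank right_selfdual => [p'|] [[|q']|] //=.
- move=> qp /(_ _ erefl) RL _ /(_ _ erefl) RS; case: eqP => [_|/eqP p'1]; first exact: RL.
  split; [exact: RL|apply: RS => //].
  by rewrite ltn_neqAle eq_sym p'1.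
- move=> qp /(_ _ erefl) RL _ /(_ _ erefl) RS; case: eqP => [_|/eqP p'1]; first exact: RL.
  split; [exact: RL|apply: RS => //].
  by rewrite ltn_neqAle eq_sym p'1.
- by move=> _ _ _ /(_ _ erefl isT); apply.
move=> _ _ /(_ _ erefl erefl) RL /(_ _ erefl isT) RS.
by split; [apply: RL|apply: RS].
Qed.

End RightCompleteness.

(** * Maximality of the left clone *)

Section LeftCompleteness.
Variables (p q : option nat) (e : endtype) (C : set boolfun).
Hypothesis pq : valid p q.
Let p1 : lep 1 p := valid_lep1 pq.
Hypotheses (Cclone : clone C) (CK : C `o` cK p q e `<=` cK p q e).

(** The resulting operation is the majority ab + bc + ca. A nonlinear function of C yields it by
    absorption of an even term of size 2 whose arguments are taken in K. *)
Lemma left_product n (g : pt n -> bool) (S : {set 'I_n.+1}) m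
    (a b c : pt m -> bool) :
  inc C g -> 1 < #|S| -> coef g S ->
  inc (cK p q e) a -> inc (cK p q e) b -> inc (cK p q e) c ->
  inc (cK p q e) (fun x => a x (+) ((b x (+) a x) && (c x (+) a x))).
Proof.
move=> Cg S1 gS Ka Kb Kc.
have K3 : xor3_closed (cK p q e) := cK_xor3 pq.
pose A j := if j is j'.+1 then if j' is 0 then b else c else a.
have KA j : inc (cK p q e) (A j) by case: j => [|[]].
apply: inc_ext (absorbs_even K3 K3 CK Cg gS (d := 2) S1 KA Ka) => x.
rewrite /mon andbT; congr (_ (+) _); apply/forallP/andP => [Ax|[Ab Ac] i].
  by split; [apply: (Ax ord0)|apply: (Ax ord_max)].
by case: i => [[|[|]]].
Qed.

(* With u, u + (x_(d+1) + x_0) and u + mon d for a, b and c, [left_product]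
   multiplies mon d by one more factor. *)
Lemma left_grow n (g : pt n -> bool) (S : {set 'I_n.+1}) d a (b : bool) :
  inc C g -> 1 < #|S| -> coef g S -> 0 < d -> lep (d + b) p -> b ==> lep d q ->
  inc (cK p q e) (@witness e d.+1 a b d.+1).
Proof.
move=> Cg S1 gS d0 dp dq.
have x_Lc j : inc cLc (fun x : pt d.+1 => x (inord j)) by apply: inc_cLc_proj.
have Ku : inc (cK p q e) (fun x : pt d.+1 => unary e (x ord0)) by apply: inc_unary.
have Kb : inc (cK p q e) (fun x : pt d.+1 => unary e (x ord0) (+)
    mon 1 true false (fun j => x (inord (if j is 0 then 0 else d.+1)))).
  by apply: (@inc_add_mon p q e d.+1 _
    (fun j x => x (inord (if j is 0 then 0 else d.+1)))).
have Kc := @inc_add_mon p q e d.+1 _ (fun j x => x (inord j)) d a b Ku x_Lc d0 dp dq.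
apply: inc_ext (left_product Cg S1 gS Ku Kb Kc) => x.
rewrite /witness; congr (_ (+) _).
rewrite [X in X && _]addbC addKb [X in _ && X]addbC addKb.
rewrite /mon andbT andbA; congr (_ && _).
apply/andP/forallP => [[/forallP A1 /forallP Ax] i|Ax]; last first.
  split; apply/forallP => i; first exact: (Ax ord_max).
  exact: (Ax (widen_ord (leqnSn d) i)).
case: (ltngtP i d) => [id|di|-> //]; first exact: (Ax (Ordinal id)).
  by move: (ltn_ord i); rewrite ltnS leqNgt di.
exact: (A1 ord0).
Qed.

Lemma left_linear_deg d : p = Some d -> C `<=` cL.
Proof.
move=> pE f /(incP C) Cf; apply/(incP cL)/inc_cD => S S1.
apply/negP => fS.
have d0 : 0 < d by move: (p1); rewrite pE.
have pd : lep (d + false) p by rewrite pE /= addn0.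
have := left_grow true Cf S1 fS d0 pd isT.
case/(witness_bound pq); first by rewrite leqnn.
by rewrite pE /= ltnn => /(_ isT).
Qed.

Lemma left_linear_rank d : p = None -> q = Some d.+1 -> C `<=` cL.
Proof.
move=> pE qE f /(incP C) Cf; apply/(incP cL)/inc_cD => S S1.
apply/negP => fS.
have pd : lep (d.+1 + true) p by rewrite pE.
have qd : true ==> lep d.+1 q by rewrite qE /=.
have := left_grow false Cf S1 fS (ltn0Sn d) pd qd.
case/(witness_bound pq) => [|_]; first by rewrite leqnn.
by rewrite qE /= ltnn => /(_ isT).
Qed.

(** With q = 0 there is no odd term to start growing from. These three end conditions however admit,
    besides the constant u = [unary e false], a member u + c + x_0; multiplying c + x_0 by x_1 + x_0
    gives an odd term of size 1. The constant c is chosen so that the end condition holds. *)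
Lemma left_linear_rank0 : p = None -> q = Some 0 ->
  match e with EAll | EL _ | ER _ => C `<=` cL | _ => True end.
Proof.
move=> pE qE.
suff main : (exists c, inc (cK p q e) (fun x : pt 1 => unary e false (+) (c (+) x ord0))) ->
    unary e false = unary e true -> C `<=` cL.
  have inK c : endok e (unary e false (+) c) (unary e false (+) ~~ c) ->
      inc (cK p q e) (fun x : pt 1 => unary e false (+) (c (+) x ord0)).
    move=> ec; apply/inc_cK; split; last by rewrite !ffunE addbF addbT.
      by rewrite pE.
    rewrite qE /=; apply: (degle_ext _ (degle_const true)) => x.
    by rewrite /der ffunE; case: (unary e false) c (x ord0) {ec} => [] [] [].
  case: e main inK => [|a|a|||a b] //= main inK; apply: main => //.
  - by exists false; apply: inK.
  - by exists false; apply: inK; rewrite addbF.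
  by exists true; apply: inK; rewrite addbF.
move=> [c Kc] ue f /(incP C) Cf; apply/(incP cL)/inc_cD => S S1.
apply/negP => fS.
have Ku : inc (cK p q e) (fun x : pt 1 => unary e (x ord0)) by apply: inc_unary.
have KW : inc (cK p q e) (@witness e 1 true false 1) by apply: inc_witness; rewrite ?pE.
have /(witness_bound pq) : inc (cK p q e) (@witness e 1 c true 1).
  apply: inc_ext (left_product Cf S1 fS Ku Kc KW) => x.
  rewrite /witness; congr (_ (+) _); rewrite [X in _ && X]addbC addKb.
  have -> : unary e (x ord0) = unary e false by case: (x ord0).
  rewrite [X in X && _]addbC addKb andbC /mon andbT andTb.
  by rewrite (_ : inord 0 = ord0) //; apply: val_inj; rewrite /= inordK.
by rewrite qE /= => /(_ isT) [_ /(_ isT)].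
Qed.

Lemma left_unary (f : boolfun) : inc C f ->
  endok e (f (cst (unary e false))) (f (cst (unary e true))).
Proof.
move=> Cf.
have /inc_cK[_ _] := inc_comp CK Cf (fun i => @inc_unary p q e 0 ord0 p1).
by congr endok; congr (bfun f _); apply/ffunP => i; rewrite !ffunE.
Qed.

Lemma left_selfdual a b : p = None -> q = Some 0 -> e = ELR a b -> a != b ->
  forall f : boolfun, inc C f -> inc cS f.
Proof.
move=> pE qE eE ab f Cf; apply/inc_cS => y.
(* These members take the values a and b at the constant points, and y_i at the point with x_0 = 0
   and x_1 = 1. The composite, whose derivative must be constant, thus compares f(y) and f(~y) with
   a and b. *)
pose A (i : 'I_(predar f).+1) (x : pt 1) := a (+) x (inord (a (+) y i)).
have KA i : inc (cK p q e) (A i).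
  apply/inc_cK; rewrite pE qE eE; split=> //=.
    apply: (degle_ext _ (degle_const true)) => x.
    by rewrite /der /A ffunE; case: (a) (x _) => [] [].
  by rewrite /A !ffunE addbF eqxx; case: (a) (b) ab => [] [].
have /inc_cK[_] := inc_comp CK Cf KA; rewrite qE eE.
move=> /degle0 /(_ [ffun i => i != ord0] (cst false)); rewrite /der compl_cst.
have -> : [ffun i => A i [ffun i => i != ord0]] = y.
  apply/ffunP => i; rewrite !ffunE /A !ffunE -val_eqE /= inordK; last by case: (_ (+) _).
  by case: (a) (y i) => [] [].
have -> : [ffun i => A i (compl [ffun i => i != ord0])] = compl y.
  apply/ffunP => i; rewrite !ffunE /A !ffunE -val_eqE /= inordK; last by case: (_ (+) _).
  by case: (a) (y i) => [] [].
move=> E /andP[/eqP fa /eqP fb]; move: E; rewrite /= fa fb.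
by case: (a) (b) ab (f y) (f (compl y)) => [] [] // _ [] [].
Qed.

Lemma left_complete : C `<=` clone2 p q e.
Proof.
move=> f Cf; have /(incP C) {}Cf := Cf; split; last first.
  apply/(incP (corr2 e)); have := left_unary Cf.
  have neq : e = ENeq -> inc cS f.
    move=> eE; apply/inc_cS => y.
    (* Each of these unary members takes unequal values y_i and ~y_i at 0 and 1, so the end
       condition on the composite says that f(y) and f(~y) differ. *)
    pose A (i : 'I_(predar f).+1) (x : pt 0) := x ord0 (+) y i.
    have KA i : inc (cK p q e) (A i).
      apply/inc_cK; split.
      - apply: (degp_lep p1); apply: degleD; [exact: degle_proj|exact: degle_const].
      - apply: (degp_ext _ (degp_const q true)) => x.
        by rewrite /der /A ffunE; case: (x ord0) (y i) => [] [].
      by rewrite eE /A !ffunE; case: (y i).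
    have /inc_cK[_ _] := inc_comp CK Cf KA; rewrite eE /=.
    have -> : [ffun i => A i (cst true)] = compl y.
      by apply/ffunP => i; rewrite !ffunE /A !ffunE.
    have -> : [ffun i => A i (cst false)] = y.
      by apply/ffunP => i; rewrite !ffunE /A !ffunE.
    by case: (f y) (f (compl y)) => [] [].
  case: e neq => [|a|a|||a b] //= neq fu; try exact/inc_cT/eqP; first exact: neq.
  by case/andP: fu => /eqP fa /eqP fb; split; apply/inc_cT.
apply/(incP (base2 p q e)).
have lin : C `<=` cL -> inc cL f.
  by move=> CL; apply: (iffLR (incP cL f)); apply: CL; apply/(incP C).
case: p q pq left_linear_deg left_linear_rank left_linear_rank0 left_selfdual
  => [p'|] [[|q']|] //=.
- by move=> _ /(_ _ erefl) RL _ _ _; apply: lin.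
- by move=> _ /(_ _ erefl) RL _ _ _; apply: lin.
- move=> _ _ _ /(_ erefl erefl) + /(_ _ _ erefl erefl).
  case: e => [|a|a|||a b] //= RL RS; try exact: lin.
  by case: eqP => // /eqP ab; apply: RS erefl ab _ Cf.
by move=> _ _ /(_ _ erefl erefl) RL _ _; apply: lin.
Qed.

End LeftCompleteness.

(** * Assembling stability and maximality; the classes of constants *)

Definition good K C1 C2 : Prop := stable cLc K /\ stability_clones K C1 C2.

Lemma comp_monotone (G G' R R' : set boolfun) :
  G `<=` G' -> R `<=` R' -> G `o` R `<=` G' `o` R'.
Proof.
move=> GG RR h [f [m [g [Gf Rg hE]]]]; exists f, m, g.
by split=> // [|i]; [apply: GG|apply: RR].
Qed.

Lemma goodP K C1 C2 : clone C1 -> clone C2 -> cLc `<=` C1 -> cLc `<=` C2 ->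
  K `o` C1 `<=` K -> C2 `o` K `<=` K ->
  (forall C, clone C -> K `o` C `<=` K -> C `<=` C1) ->
  (forall C, clone C -> C `o` K `<=` K -> C `<=` C2) ->
  good K C1 C2.
Proof.
move=> c1 c2 L1 L2 K1 K2 max1 max2.
have right C : C `<=` C1 -> K `o` C `<=` K.
  by move=> C1C; apply: subset_trans K1; apply: comp_monotone.
have left C : C `<=` C2 -> C `o` K `<=` K.
  by move=> C2C; apply: subset_trans K2; apply: comp_monotone.
split; first by split; [apply: right|apply: left].
split=> // C cC; split; split; [exact: max1|exact: right|exact: max2|exact: left].
Qed.

Lemma cK_good p q e : valid p q -> good (cK p q e) (clone1 p q e) (clone2 p q e).
Proof.
move=> pq; apply: goodP.
- exact: clone1_clone.
- exact: clone2_clone.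
- exact: cLc_clone1.
- exact: cLc_clone2.
- exact: cK_clone1.
- exact: clone2_cK.
- by move=> C; apply: right_complete.
by move=> C _; apply: left_complete.
Qed.

Lemma degle0_comp n m (f : pt n -> bool) (A : 'I_n.+1 -> pt m -> bool) :
  degle 0 f -> degle 0 (fun x => f [ffun i => A i x]).
Proof. by move=> f0; apply: (degle_comp f0 (fun i => @degle_max _ (A i))). Qed.

Lemma D0_good : good (cD 0) Omega Omega.
Proof.
apply: goodP => //.
  by apply: sub_comp => n m f A /inc_cD f0 _; apply/inc_cD/degle0_comp.
apply: sub_comp => n m f A _ A0; apply/inc_cD; rewrite -(muln0 n.+1).
by apply: (degle_comp (@degle_max _ f)) => i; apply/inc_cD.
Qed.

Lemma inc_Omega_l a n (h : pt n -> bool) : inc (Omega_l a) h <-> h (cst false) = a.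
Proof. by rewrite (inc_cE (EL a)) /=; split=> /eqP. Qed.

Lemma D0_l_good a : good (cD 0 `&` Omega_l a) Omega (cT a).
Proof.
have const_a : inc (cD 0 `&` Omega_l a) (fun _ : pt 0 => a).
  by split; [apply/inc_cD/degle_const|apply/inc_Omega_l].
apply: goodP => //; first exact: cT_clone.
- by move=> f [_ [f0 f1]]; case: a {const_a}.
- apply: sub_comp => n m f A [/inc_cD f0 /inc_Omega_l fa] _.
  split; first exact/inc_cD/degle0_comp.
  by apply/inc_Omega_l; rewrite -fa; apply: degle0.
- apply: sub_comp => n m f A /inc_cT fa A0; split.
    apply/inc_cD; rewrite -(muln0 n.+1).
    by apply: (degle_comp (@degle_max _ f)) => i; have [/inc_cD] := A0 i.
  apply/inc_Omega_l; rewrite (@cst_comp _ _ _ _ a) // => i.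
  by have [_ /inc_Omega_l] := A0 i.
move=> C _ CK f /(incP C) Cf; apply/(incP (cT a))/inc_cT.
have [_ /inc_Omega_l] := inc_comp CK Cf (fun=> const_a).
by [].
Qed.

Lemma empty_good : good set0 Omega Omega.
Proof.
apply: goodP => //; first by move=> h [f [m [g [[]]]]].
by move=> h [f [m [g [_ /(_ ord0)]]]].
Qed.

(** * Classification of the stable classes *)

(** For x_0 = 0 this is the Zhegalkin expansion; for x_0 = 1 it is the sum of the expansions of h
    and of its derivative, both at ~x. Here x_0 is a variable of h itself: if S contains it, the
    term vanishes through the factor x_0 + x_0. *)
Lemma decompose n (h : pt n -> bool) x :
  h x = h (cst false) (+) ((h (cst false) (+) h (cst true)) && x ord0) (+)
    \big[addb/false]_(S : {set 'I_n.+1} | 0 < #|S|)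
      mon #|S| (coef h S) (coef (der h) S)
        (fun j => x (if j is j'.+1 then nth ord0 (enum S) j' else ord0)).
Proof.
have monE (S : {set 'I_n.+1}) a b :
    mon #|S| a b (fun j => x (if j is j'.+1 then nth ord0 (enum S) j' else ord0))
    = (a (+) (b && x ord0)) && [forall i in S, x i (+) x ord0].
  rewrite andbC; congr (_ && _).
  apply/forallP/'forall_implyP => [xS i iS|xS i]; last first.
    by apply: xS; rewrite -mem_enum mem_nth // -cardE.
  rewrite -mem_enum in iS.
  have lt : index i (enum S) < #|S| by rewrite cardE index_mem.
  by have := xS (Ordinal lt); rewrite /= nth_index.
have mob0 (k : pt n -> bool) y : k y = k (cst false) (+)
    \big[addb/false]_(S : {set 'I_n.+1} | 0 < #|S|) (coef k S && [forall i in S, y i]).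
  rewrite moebius (bigD1 finset.set0) //=; congr (_ (+) _); last first.
    by apply: eq_bigl => S; rewrite card_gt0.
  rewrite (_ : [forall i in _, y i] = true) ?andbT; last first.
    by apply/forallP => i; rewrite finset.in_set0.
  rewrite /coef finset.powerset0 finset.big_set1; congr k.
  by apply/ffunP => i; rewrite !ffunE finset.in_set0.
under eq_bigr => S _ do rewrite monE.
case x0: (x ord0).
  have -> : h x = h (compl x) (+) der h (compl x).
    by rewrite /der complK addKb.
  rewrite [X in X (+) _]mob0 [X in _ (+) X]mob0 /der compl_cst addbACA.
  rewrite -big_split /= andbT; congr (_ (+) _).
  apply: eq_bigr => S _; rewrite andbT -andb_addl; congr (_ && _).
  by apply: eq_forallb => i; rewrite ffunE addbT.
rewrite [LHS]mob0 andbF addbF; congr (_ (+) _); apply: eq_bigr => S _.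
rewrite andbF addbF; congr (_ && _).
by apply: eq_forallb => i; rewrite addbF.
Qed.

Lemma antitone_bound (P : nat -> Prop) : (forall d, P d.+1 -> P d) ->
  exists p, forall d, 0 < d -> (P d <-> lep d p).
Proof.
move=> Pdecr.
have Pmono d d' : d <= d' -> P d' -> P d.
  by move/subnK <-; elim: (d' - d) => // k IHk /Pdecr.
case: (pselect (forall d, P d)) => [allP|nP]; first by exists None.
have [d0 d0P] : exists d, ~~ `[< P d >].
  apply: contrapT => E; apply: nP => d; apply: contrapT => nPd; apply: E.
  by exists d; apply/asboolPn.
case: (ex_minnP (ex_intro (fun d => ~~ `[< P d >]) d0 d0P)) => m /asboolPn nPm mmin.
(* If m = 0 the truncated predecessor is 0, which is still right because only positive d are
   compared. *)
exists (Some m.-1) => d d1; split=> [Pd|/= dm].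
  rewrite /= -ltnS; case: (ltnP d m) => [|md]; first by case: (m).
  by case: nPm; apply: Pmono Pd.
apply: contrapT => nPd; have : m <= d by apply: mmin; apply/asboolPn.
case: (m) dm => [|m'] /=; first by rewrite leqNgt d1.
by move=> dm md; have := leq_trans md dm; rewrite ltnn.
Qed.

(** A nonempty subset of GF(2)^2 closed under sums of three points is an affine subspace; the proof
    inspects all 16 subsets. *)
Lemma endtype_of (E : bool -> bool -> Prop) : (exists a b, E a b) ->
  (forall a a' b b' c c', E a a' -> E b b' -> E c c' ->
    E (a (+) (b (+) c)) (a' (+) (b' (+) c'))) ->
  exists e, forall a b, E a b <-> endok e a b.
Proof.
move=> [a0 [b0 E0]] E3.
pose F a b := `[< E a b >].
have F3 a a' b b' c c' : F a a' -> F b b' -> F c c' ->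
    F (a (+) (b (+) c)) (a' (+) (b' (+) c')).
  by move=> /asboolP Ea /asboolP Eb /asboolP Ec; apply/asboolP; apply: E3.
suff [e eE] : exists e, forall a b, F a b = endok e a b.
  by exists e => a b; rewrite -eE; split=> /asboolP.
have F0 : F a0 b0 by apply/asboolP.
move: F F3 F0 => {E E3 E0} F F3 F0.
(* Each of [T1] to [T4] says that three of the four points force the last one. *)
have T1 := F3 false false false true true false.
have T2 := F3 false false false true true true.
have T3 := F3 false false true false true true.
have T4 := F3 false true true false true true.
case F00: (F false false) T1 T2 T3 T4; case F01: (F false true);
case F10: (F true false); case F11: (F true true) => T1 T2 T3 T4;
first [ by have := T1 isT isT isT
      | by have := T2 isT isT isT
      | by have := T3 isT isT isT
      | by have := T4 isT isT isT
      | by move: F0; case: (a0) (b0) => [] []; rewrite ?F00 ?F01 ?F10 ?F11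
      | by exists EAll => -[] []
      | by exists (EL false) => -[] [] | by exists (EL true) => -[] []
      | by exists (ER false) => -[] [] | by exists (ER true) => -[] []
      | by exists EEq => -[] [] | by exists ENeq => -[] []
      | by exists (ELR false false) => -[] [] | by exists (ELR false true) => -[] []
      | by exists (ELR true false) => -[] [] | by exists (ELR true true) => -[] [] ].
Qed.

Section Classification.
Variable K : set boolfun.
Hypotheses (Kstable : stable cLc K).

Let KL : K `o` cLc `<=` K := Kstable.1.
Let K3 : xor3_closed K := xor3_stable Kstable.2.

(** The inequality on |S| makes the predicate antitone in d, as [antitone_bound] requires in order
    to produce p; likewise [has_rank] produces q. *)
Definition has_degree d : Prop := exists f : boolfun, K f /\
  exists2 S : {set 'I_(predar f).+1}, d <= #|S| & coef f S.
Definition has_rank d : Prop := exists f : boolfun, K f /\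
  exists2 S : {set 'I_(predar f).+1}, d <= #|S| & coef (der f) S.
Definition has_ends (a b : bool) : Prop := exists f : boolfun, K f /\
  (f (cst false) = a /\ f (cst true) = b).

Lemma has_degreeS d : has_degree d.+1 -> has_degree d.
Proof. by move=> [f [Kf [S /ltnW]]]; exists f; split=> //; exists S. Qed.

Lemma has_rankS d : has_rank d.+1 -> has_rank d.
Proof. by move=> [f [Kf [S /ltnW]]]; exists f; split=> //; exists S. Qed.

Lemma has_rank_degree d : has_rank d -> has_degree d.+1.
Proof.
move=> [f [Kf [S dS]]]; rewrite coef_der => odd_S.
have /card_gt0P[A] : 0 < #|[pred A in monomials f | S \proper A]| by case: #|_| odd_S.
rewrite inE -coef_monomials => /andP[fA /proper_card SA].
by exists f; split=> //; exists A => //; apply: leq_ltn_trans SA.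
Qed.

Lemma has_ends_unary a b n i : has_ends a b ->
  inc K (fun x : pt n => a (+) ((a (+) b) && x i)).
Proof.
move=> [f [/(incP K) Kf [fa fb]]].
apply: inc_ext (inc_comp KL Kf (fun=> inc_cLc_proj i)) => x.
by case: (x i); rewrite ?fa ?fb; case: (a) (b) => [] [].
Qed.

Lemma inc_absorb d (a b : bool) n (k : pt n -> bool) (A : nat -> pt n -> bool) :
  0 < d -> (a -> has_degree d) -> (b -> has_rank d) -> (forall j, inc cLc (A j)) ->
  inc K k -> inc K (fun x => k x (+) mon d a b (fun j => A j x)).
Proof.
move=> d0 dP dQ LA Kk.
have Ka : inc K (fun x => k x (+) mon d a false (fun j => A j x)).
  case: a dP => [/(_ isT)[f [/(incP K) Kf [S dS fS]]]|_].
    by apply: (absorbs_even cLc_xor3 K3 KL Kf fS) => //; rewrite d0.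
  by apply: inc_ext Kk => x; rewrite /mon andbF addbF.
have Kb : inc K (fun x => k x (+) mon d a false (fun j => A j x)
                              (+) mon d false b (fun j => A j x)).
  case: b dQ => [/(_ isT)[f [/(incP K) Kf [S dS fS]]]|_].
    by apply: (absorbs_odd cLc_xor3 K3 KL Kf fS) => //; rewrite d0.
  by apply: inc_ext Ka => x; rewrite -[LHS]addbF; congr (_ (+) _); rewrite /mon /= andbF.
apply: inc_ext Kb => x; rewrite -addbA; congr (_ (+) _).
by rewrite /mon -andb_addr andFb addbF.
Qed.

Lemma inc_stable n (h : pt n -> bool) : inc K h <->
  [/\ forall S : {set 'I_n.+1}, 0 < #|S| -> coef h S -> has_degree #|S|,
      forall S : {set 'I_n.+1}, 0 < #|S| -> coef (der h) S -> has_rank #|S|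
    & has_ends (h (cst false)) (h (cst true))].
Proof.
split=> [Kh|[hP hQ hE]].
  split=> [S _ hS|S _ hS|].
  - by exists (BoolFun [ffun x => h x]); split=> //; exists S => //=; rewrite coef_ffun.
  - by exists (BoolFun [ffun x => h x]); split=> //; exists S => //=; rewrite coef_der_ffun.
  by exists (BoolFun [ffun x => h x]); split=> //=; rewrite !ffunE.
apply: inc_ext (fun x => esym (decompose h x)) _.
(* The sums of terms need not be in K. What is additive is the set of functions that may be added to
   every member; the member to start from is the unary one with the given ends. *)
apply: (@addclosed_sum n (fun t => forall k, inc K k -> inc K (fun x => k x (+) t x))).
- by move=> k; apply: inc_ext => x; rewrite addbF.
- by move=> t t' Xt Xt' k Kk; apply: inc_ext (Xt' _ (Xt _ Kk)) => x; rewrite addbA.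
- move=> S S0 k Kk.
  apply: (@inc_absorb _ _ _ n k
    (fun j x => x (if j is j'.+1 then nth ord0 (enum S) j' else ord0))) => //.
  + exact: hP.
  + exact: hQ.
  by move=> j; apply: inc_cLc_proj.
exact: has_ends_unary.
Qed.

Lemma degp_bound (P : nat -> Prop) p n (h : pt n -> bool) :
  (forall d, 0 < d -> (P d <-> lep d p)) ->
  (forall S : {set 'I_n.+1}, 0 < #|S| -> coef h S -> P #|S|) <-> degp p h.
Proof.
move=> Pp; split=> [hP|hp S S0 hS]; last first.
  apply/Pp => //; case: (p) hp => //= p' hp.
  by rewrite leqNgt; apply: contraL hS => /hp ->.
case: p Pp => //= p Pp S pS; apply/negP => hS.
have S0 : 0 < #|S| by apply: leq_ltn_trans pS.
by have := (Pp _ S0).1 (hP _ S0 hS); rewrite /= leqNgt pS.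
Qed.

Lemma classification : [\/ K = set0, K = cD 0,
  exists a, K = cD 0 `&` Omega_l a
  | exists p q e, valid p q /\ K = cK p q e].
Proof.
case: (pselect (exists f, K f)) => [[f0 Kf0]|nK]; last first.
  by constructor 1; apply/seteqP; split=> f // Kf; case: nK; exists f.
have [p pP] := antitone_bound has_degreeS.
have [q qP] := antitone_bound has_rankS.
have [e eP] : exists e, forall a b, has_ends a b <-> endok e a b.
  apply: endtype_of; first by exists (f0 (cst false)), (f0 (cst true)), f0.
  move=> a a' b b' c c' Ea Eb Ec.
  have := K3 (has_ends_unary (ord0 : 'I_1) Ea) (has_ends_unary (ord0 : 'I_1) Eb).
  move=> /(_ _ (has_ends_unary ord0 Ec))/inc_stable[_ _].
  by rewrite !ffunE !andbF !addbF !andbT !addKb.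
have KE : K = cK p q e.
  apply/seteqP; split=> f; rewrite (incP K f) (incP (cK p q e) f) inc_stable inc_cK.
    by move=> [fP fQ fE]; split; [apply/(degp_bound f pP)|apply/(degp_bound (der f) qP)|apply/eP].
  by move=> [fP fQ fE]; split; [apply/(degp_bound f pP)|apply/(degp_bound (der f) qP)|apply/eP].
have qp d : 0 < d -> lep d q -> lep d.+1 p by move=> d0 /(qP _ d0)/has_rank_degree/(pP d.+1 isT).
case: (boolP (valid p q)) => [pq|npq]; first by constructor 4; exists p, q, e.
(* A positive bound p would give q < p through [has_rank_degree], hence a valid pair. What remains
   are constants: their ends agree, so K contains both values or exactly one. *)
have p0 : p = Some 0.
  case: p q qp npq {pP qP KE} => [p|//] [q|] /= qp.
    rewrite -leqNgt; case: q qp => [|q] qp; first by case: (p).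
    by move=> pq; have := leq_trans (qp q.+1 isT (leqnn _)) pq; rewrite ltnn.
  by case: p qp => // p /(_ p.+1 isT isT); rewrite ltnn.
have ab a b : endok e a b -> a = b.
  move=> /eP[f [/(incP K)]]; rewrite KE p0 => /inc_cK[/= f0' _ _] [<- <-].
  exact: degle0 f0' _ _.
have KE0 f : K f <-> cD 0 f /\ endok e (f (cst false)) (f (cst false)).
  rewrite (incP (cD 0) f) KE p0 (incP (cK _ _ _) f) inc_cK inc_cD /=.
  split=> [[f1 _]|[f1 fe]]; first by rewrite (degle0 f1 (cst true) (cst false)).
  split=> //; last by rewrite (degle0 f1 (cst true) (cst false)).
  apply: (degp_ext _ (degp_const q false)) => x.
  by rewrite /der (degle0 f1 (compl x) x) addbb.
have [a ea] : exists a, endok e a a.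
  have /KE0[_ ?] := Kf0; by exists (f0 (cst false)).
case: (boolP (endok e (~~ a) (~~ a))) => [ena|/negP ena].
  constructor 2; apply/seteqP; split=> f; first by case/KE0.
  by move=> f1; apply/KE0; split=> //; case: (f _) a ea ena => [] [].
constructor 3; exists a; apply/seteqP; split=> f.
  move=> /KE0[f1 fe]; split=> //; apply: contrapT => fa; apply: ena.
  have <- // : f (cst false) = ~~ a.
  by move: fa; rewrite /Omega_l /value_at /=; case: (f _) (a) => [] [] // /(_ erefl).
by move=> [f1 fa]; apply/KE0; split=> //; rewrite (_ : f (cst false) = a).
Qed.

End Classification.

(** * Translation between the parameters and the rows of the table *)

Lemma cD_sub_cX d : cD d.+1 `<=` cX d.+1.
Proof.
move=> f /(incP (cD d.+1)) /inc_cD fd; apply/(incP (cX d.+1))/inc_cX_degle.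
exact: degle_der.
Qed.

(** Self-duality carries the value at one constant point to the other, which is why S meets T_0 and
    T_1 in the same clone S_c. *)
Lemma cS_cTc a n (h : pt n -> bool) : inc cS h -> inc (cT a) h -> inc cTc h.
Proof.
move=> /inc_cS/(_ (cst false)); rewrite compl_cst inc_cT inc_cTc /=.
by case: a; case: (h (cst true)) (h (cst false)) => [] [].
Qed.

Lemma cSE a : cS `&` cT a = cSc.
Proof.
apply/seteqP; split=> f [fS fa].
  split=> //; apply: (iffRL (incP cTc f)); apply: (@cS_cTc a).
    exact: (iffLR (incP cS f)).
  exact: (iffLR (incP (cT a) f)).
by split=> //; case: (a) fa => -[].
Qed.

Lemma cSc_L : cL `&` cSc = cLc.
Proof.
apply/seteqP; split=> f; first by case=> fL [].
move=> Lf; have [fL fc] := Lf; split=> //; split=> //.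
by apply: (iffRL (incP cS f)); apply: cLc_sub_cS; apply: (iffLR (incP cLc f)).
Qed.

Lemma cLSE a : cLS `&` cT a = cLc.
Proof. by rewrite /cLS -setIA cSE cSc_L. Qed.

Lemma cLS_cTc : cLS `&` cTc = cLc.
Proof. by rewrite /cLS -setIA cSc_L. Qed.

Lemma cLS_cS : cLS `&` cS = cLS.
Proof. by rewrite /cLS -setIA setIid. Qed.

Lemma cT_neq a b : a <> b -> cT a `&` cT b = cTc.
Proof. by case: a b => [] [] // _; rewrite setIC. Qed.

Lemma setIll (K A B : set boolfun) : K `&` (A `&` B) = K `&` A `&` (K `&` B).
Proof. by rewrite setIACA setIid. Qed.

Lemma good_row p q e K C1 C2 : valid p q -> cK p q e = K ->
  clone1 p q e = C1 -> clone2 p q e = C2 -> good K C1 C2.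
Proof. by move=> pq <- <- <-; apply: cK_good. Qed.

Lemma cK_D d e : cK (Some d.+1) (Some d) e = cD d.+1 `&` cE e.
Proof. by rewrite /cK /= (setIidl (@cD_sub_cX d)). Qed.

Local Opaque cD cX cS cT cL Omega_l Omega_r Omega_eq Omega_neq.

Definition rowE := (cLSE, cSE, cLS_cTc, cLS_cS, @setTI boolfun, @setIT boolfun,
  @setIid boolfun).

Local Ltac row p q e := apply: (@good_row p q e); rewrite ?cK_D /cK /clone1 /clone2 /=
  ?eqxx ?rowE //.

(** X_k is (no bound, k - 1), D_k is (k, k - 1), and the intersection of D_i and X_j is (i, j - 1),
    where j < i makes p differ from q + 1. *)
Lemma table_good K C1 C2 : table K C1 C2 -> good K C1 C2.
Proof.
case=> {K C1 C2}.
- by row (None : option nat) (None : option nat) EAll.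
- by move=> a; row (None : option nat) (None : option nat) (EL a).
- by move=> a; row (None : option nat) (None : option nat) (ER a).
- by row (None : option nat) (None : option nat) EEq.
- by row (None : option nat) (None : option nat) ENeq.
- by move=> a b; row (None : option nat) (None : option nat) (ELR a b).
- by move=> [|[|k]] // _; row (None : option nat) (Some k.+1) EAll.
- by row (None : option nat) (Some 0) EAll.
- by move=> [|[|k]] a // _; row (None : option nat) (Some k.+1) (EL a).
- by move=> a; row (None : option nat) (Some 0) (EL a).
- by move=> [|[|k]] a // _; row (None : option nat) (Some k.+1) (ER a).
- by move=> a; row (None : option nat) (Some 0) (ER a).
- by move=> [|[|k]] // _; row (None : option nat) (Some k.+1) EEq.
- by row (None : option nat) (Some 0) EEq.
- by move=> [|[|k]] // _; row (None : option nat) (Some k.+1) ENeq.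
- by row (None : option nat) (Some 0) ENeq.
- by move=> [|[|k]] a b // _; row (None : option nat) (Some k.+1) (ELR a b); rewrite setIll.
- by move=> a b ->; row (None : option nat) (Some 0) (ELR b b).
- move=> a b ab; row (None : option nat) (Some 0) (ELR a b).
  by case: eqP => //; rewrite cT_neq.
- by move=> [|k] // _; row (Some k.+1) (Some k) EAll.
- by move=> [|k] a // _; row (Some k.+1) (Some k) (EL a).
- by move=> [|k] a // _; row (Some k.+1) (Some k) (ER a).
- by move=> [|[|k]] // _; row (Some k.+2) (Some k.+1) EEq.
- by row (Some 1) (Some 0) EEq.
- by move=> [|[|k]] // _; row (Some k.+2) (Some k.+1) ENeq.
- by row (Some 1) (Some 0) ENeq.
- by move=> [|k] a b // _; row (Some k.+1) (Some k) (ELR a b); rewrite setIll.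
- by move=> i [|j] //= ij; row (Some i) (Some j) EAll; rewrite ?gtn_eqF ?rowE // ltnW.
- by move=> i [|j] a //= ij; row (Some i) (Some j) (EL a); rewrite ?gtn_eqF ?rowE // ltnW.
- by move=> i [|j] a //= ij; row (Some i) (Some j) (ER a); rewrite ?gtn_eqF ?rowE // ltnW.
- by move=> i [|[|j]] //= ij; row (Some i) (Some j.+1) EEq; rewrite ?gtn_eqF ?rowE // ltnW.
- by move=> i ij; row (Some i) (Some 0) EEq; rewrite ?gtn_eqF ?rowE // ltnW.
- by move=> i [|[|j]] //= ij; row (Some i) (Some j.+1) ENeq; rewrite ?gtn_eqF ?rowE // ltnW.
- by move=> i ij; row (Some i) (Some 0) ENeq; rewrite ?gtn_eqF ?rowE // ltnW.
- by move=> i [|j] a b //= ij; row (Some i) (Some j) (ELR a b);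
    rewrite ?gtn_eqF ?rowE 1?setIll // ltnW.
- exact: D0_good.
- exact: D0_l_good.
exact: empty_good.
Qed.

Lemma cK_table p q e : valid p q -> exists C1 C2, table (cK p q e) C1 C2.
Proof.
case: p q => [[|p]|] [q|] //=; rewrite ?ltnS.
- rewrite leq_eqVlt => /orP[/eqP ->|qp].
    rewrite cK_D; case: e => [|a|a|||a b] /=; rewrite ?setIT.
    + by do 2 eexists; apply: row_D.
    + by do 2 eexists; apply: row_D_l.
    + by do 2 eexists; apply: row_D_r.
    + case: p => [|p]; do 2 eexists; [exact: row_D1_eq|exact: row_D_eq].
    + case: p => [|p]; do 2 eexists; [exact: row_D1_neq|exact: row_D_neq].
    by do 2 eexists; apply: row_D_lr.
  rewrite /cK /=; case: e => [|a|a|||a b] /=; rewrite ?setIT.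
  + by do 2 eexists; apply: row_DX.
  + by do 2 eexists; apply: row_DX_l.
  + by do 2 eexists; apply: row_DX_r.
  + case: q qp => [|q] qp; do 2 eexists; [exact: row_DX1_eq|exact: row_DX_eq].
  + case: q qp => [|q] qp; do 2 eexists; [exact: row_DX1_neq|exact: row_DX_neq].
  by do 2 eexists; apply: row_DX_lr.
- move=> _; rewrite /cK /= setTI; case: e => [|a|a|||a b] /=; rewrite ?setIT.
  + case: q => [|q]; do 2 eexists; [exact: row_X1|exact: row_X].
  + case: q => [|q]; do 2 eexists; [exact: row_X1_l|exact: row_X_l].
  + case: q => [|q]; do 2 eexists; [exact: row_X1_r|exact: row_X_r].
  + case: q => [|q]; do 2 eexists; [exact: row_X1_eq|exact: row_X_eq].
  + case: q => [|q]; do 2 eexists; [exact: row_X1_neq|exact: row_X_neq].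
  case: q => [|q]; last by do 2 eexists; apply: row_X_lr.
  by case: (pselect (a = b)) => ab; do 2 eexists; [apply: row_X1_lr_eq|apply: row_X1_lr_neq].
move=> _; rewrite /cK /= !setTI; case: e => [|a|a|||a b] /=.
+ by do 2 eexists; apply: row_Omega.
+ by do 2 eexists; apply: row_Omega_l.
+ by do 2 eexists; apply: row_Omega_r.
+ by do 2 eexists; apply: row_Omega_eq.
+ by do 2 eexists; apply: row_Omega_neq.
by do 2 eexists; apply: row_Omega_lr.
Qed.

Lemma stable_table K : stable cLc K -> exists C1 C2, table K C1 C2.
Proof.
move=> /classification[->|->|[a ->]|[p [q [e [pq ->]]]]].
- by do 2 eexists; apply: row_empty.
- by do 2 eexists; apply: row_D0.
- by do 2 eexists; apply: row_D0_l.
exact: cK_table.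
Qed.

Theorem theorem7p1 :
  (forall K : set boolfun, stable cLc K ->
     exists C1 C2 : set boolfun, table K C1 C2 /\ stability_clones K C1 C2)
  /\
  (forall K C1 C2 : set boolfun, table K C1 C2 ->
     stable cLc K /\ stability_clones K C1 C2).
Proof.
split=> [K /stable_table[C1 [C2 KC]]|]; last exact: table_good.
by exists C1, C2; split=> //; have [] := table_good KC.
Qed.
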